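(* Let $V=[\mathbf{TR}^{\mathrm{op}},\mathbf{Set}]$ be the $T_2$-multicategory described in the context. A plain multicategory enriched in $V$ is the same thing as a relaxed multicategory. That is, for every set $C_0$ there is a one-to-one correspondence between plain multicategories enriched in $V$ with object-set $C_0$ and relaxed multicategories with object-set $C_0$, under which an enriched plain multicategory $(C[-;-],\kappa)$ corresponds to the relaxed multicategory $C$ in which: $C_\tau(a_1,\ldots,a_n;a)=C[a_1,\ldots,a_n;a](\tau)$ for $\tau\in\mathbf{TR}(n)$; the functions $f\mapsto f.\phi$ are given by the functors $C[a_1,\ldots,a_n;a]:\mathbf{TR}(n)^{\mathrm{op}}\to\mathbf{Set}$; composition at $(\tau,\tau_1,\ldots,\tau_n)$ is the component at $(\tau,\tau_1,\ldots,\tau_n)$ of the arrow $\kappa_D$, where $D$ is the two-level edge-labelled tree with root edge labelled $a$, root vertex having $n$ inputs labelled $a_1,\ldots,a_n$, the $i$-th of which is the output of a vertex with $k_i$ inputs, all leaves, labelled $a_i^1,\ldots,a_i^{k_i}$; and the identity $1_a$ is given by $\kappa_D$ where $D$ is the trivial tree labelled $a$.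
   Context: Trees. The objects of $\mathbf{TR}(n)$ are the $n$-leafed (finite, planar, rooted) trees, defined inductively: the trivial tree $\bullet$ (one edge, no vertices) is in $\mathbf{TR}(1)$; if $n\ge 0$ and $\tau_i\in\mathbf{TR}(k_i)$ for $1\le i\le n$ then $\langle\tau_1,\ldots,\tau_n\rangle$ (a root vertex with $n$ inputs, with $\tau_i$ grafted onto the $i$-th input) is in $\mathbf{TR}(k_1+\cdots+k_n)$. The $n$-corolla is $\langle\bullet,\ldots,\bullet\rangle$ ($n$ copies). Vertices may have any number $k\geq 0$ of inputs. The composite $\tau\circ(\tau_1,\ldots,\tau_n)$ is obtained by grafting $\tau_i$ onto the $i$-th leaf of $\tau$. If $\tau$ is a tree and for each vertex $v$ of $\tau$, with $k_v$ inputs, $\sigma_v$ is a tree with $k_v$ leaves, then $\tau[\sigma_v]$ denotes the tree obtained by substituting $\sigma_v$ for $v$, for all $v$. A map $\tau'\to\tau$ in the category $\mathbf{TR}(n)$ is a family $(\sigma_v)_v$ of trees, $\sigma_v\in\mathbf{TR}(k_v)$, indexed by the vertices $v$ of $\tau$, with $\tau[\sigma_v]=\tau'$; maps are composed by substitution and identities are given by corollas. Grafting extends to maps (written $\phi\circ(\phi_1,\ldots,\phi_n)$), making $\mathbf{TR}$ a (non-symmetric) operad in $(\mathbf{Cat},\times)$ with identity $\bullet$; substitution $(\tau_v)_v\mapsto T[\tau_v]$ is likewise functorial in the $\tau_v\in\mathbf{TR}(k_v)$, for each fixed tree $T$. $T_2$-multicategories. A $T_2$-multicategory $V$ consists of: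 for each $n\in\mathbb{N}$ a class of objects over $n$; for each tree $T$ with $n$ leaves, family $(X_v)$ assigning to each vertex $v$ of $T$ (with $k_v$ inputs) an object $X_v$ over $k_v$, and object $X$ over $n$, a set of arrows $(T,(X_v)_v)\to X$; an identity arrow on each object $X$ over $n$, whose domain is the $n$-corolla labelled $X$; and a composition which to an arrow $(T,(X_v))\to X$ and arrows $(T_v,\ldots)\to X_v$ (one for each vertex $v$ of $T$) assigns an arrow to $X$ whose domain is the labelled tree obtained by substituting the labelled trees $T_v$ for the vertices of $T$; subject to associativity and identity laws. The $T_2$-multicategory $[\mathbf{TR}^{\mathrm{op}},\mathbf{Set}]$. An object over $n$ is a functor $\mathbf{TR}(n)^{\mathrm{op}}\to\mathbf{Set}$. An arrow $(T,(F_v)_v)\to F$ is a family of functions $\prod_v F_v(\tau_v)\to F(T[\tau_v])$, one for each family $(\tau_v)_v$ with $\tau_v\in\mathbf{TR}(k_v)$, natural in the $\tau_v$'s. Composition and identities are those of functions. Plain multicategories enriched in a $T_2$-multicategory $V$. Such a thing consists of a set $C_0$; for each $a_1,\ldots,a_n,a\in C_0$ ($n\geq 0$) an object $C[a_1,\ldots,a_n;a]$ of $V$ over $n$; and for each tree $D$ with every edge labelled by an element of $C_0$, an arrow $\kappa_D$ of $V$ whose domain is the underlying tree of $D$ with each vertex $v$ labelled by $C[b_1,\ldots,b_k;b]$, where $b_1,\ldots,b_k$ are the labels of the input edges of $v$ (in order) and $b$ the label of its output edge, and whose codomain is $C[a_1,\ldots,a_n;a]$, where $a_1,\ldots,a_n$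 are the labels of the leaves of $D$ and $a$ the label of its root edge. These are required to be closed under composition and identities: if $D$ is obtained from $D'$ by substituting edge-labelled trees $D_v$ (with matching boundary labels) for the vertices $v$ of $D'$, then $\kappa_D$ is the composite of $\kappa_{D'}$ with the $\kappa_{D_v}$; and if $D$ is a corolla then $\kappa_D$ is an identity. Relaxed multicategories. A relaxed multicategory $C$ consists of: a set $C_0$ of objects; for each $\tau\in\mathbf{TR}(n)$ and $a_1,\ldots,a_n,a\in C_0$ a set $C_\tau(a_1,\ldots,a_n;a)$; for each map $\phi:\tau'\to\tau$ in $\mathbf{TR}(n)$ a function $C_\tau(a_1,\ldots,a_n;a)\to C_{\tau'}(a_1,\ldots,a_n;a)$, $f\mapsto f.\phi$; for each $\tau\in\mathbf{TR}(n)$, $\tau_i\in\mathbf{TR}(k_i)$, a composition function $$C_{\tau_1}(a_1^1,\ldots,a_1^{k_1};a_1)\times\cdots\times C_{\tau_n}(a_n^1,\ldots,a_n^{k_n};a_n)\times C_\tau(a_1,\ldots,a_n;a)\to C_{\tau\circ(\tau_1,\ldots,\tau_n)}(a_1^1,\ldots,a_n^{k_n};a),$$ written $(f_1,\ldots,f_n,f)\mapsto f\circ(f_1,\ldots,f_n)$; and for each $a\in C_0$ an element $1_a\in C_\bullet(a;a)$; such that $f.(\phi\circ\phi')=(f.\phi).\phi'$ and $f.1=f$; composition is associative with the $1_a$ as two-sided identities; and $(f\circ(f_1,\ldots,f_n)).(\phi\circ(\phi_1,\ldots,\phi_n))=(f.\phi)\circ(f_1.\phi_1,\ldots,f_n.\phi_n)$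 whenever this makes sense. *)

(* Defs.v *)
From mathcomp Require Import all_boot all_order.
From mathcomp Require Import boolp.
Set Implicit Arguments.
Unset Strict Implicit.
Unset Printing Implicit Defensive.
Import Order.TTheory.

(* Children are given by functions on 'I_k, so equality of trees relies on
   functional extensionality. *)
Inductive tree : Type :=
| leaf
| node (k : nat) (ts : 'I_k -> tree).

(* In [vertex (node ts)], [None] is the root vertex. *)
Fixpoint vertex (t : tree) : Type :=
  match t with
  | leaf => void
  | node k ts => option {i : 'I_k & vertex (ts i)}
  end.

Fixpoint arity (t : tree) : vertex t -> nat :=
  match t return vertex t -> nat with
  | leaf => fun v => match v with end
  | node k ts => fun v =>
      match v with
      | None => k
      | Some (existT i w) => arity w
      end
  end.

Definition vsub k (ts : 'I_k -> tree) i (w : vertex (ts i)) : vertex (node ts) :=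
  Some (existT (fun i => vertex (ts i)) i w).

Definition node_rect k (ts : 'I_k -> tree) (P : vertex (node ts) -> Type)
    (p0 : P None) (p1 : forall i w, P (vsub w)) v : P v :=
  match v with
  | None => p0
  | Some (existT i w) => p1 i w
  end.

Fixpoint leafpos (t : tree) : Type :=
  match t with
  | leaf => unit
  | node k ts => {i : 'I_k & leafpos (ts i)}
  end.

Definition lsub k (ts : 'I_k -> tree) i (l : leafpos (ts i)) : leafpos (node ts) :=
  existT (fun i => leafpos (ts i)) i l.

Fixpoint nleaves (t : tree) : nat :=
  match t with
  | leaf => 1
  | node k ts => \sum_(i < k) nleaves (ts i)
  end.

(* The planar (left to right) numbering of the leaves. [tagnat.Rank i j] is the
   position of the pair (i, j) in the lexicographic order. *)
Fixpoint leaf_index (t : tree) : leafpos t -> 'I_(nleaves t) :=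
  match t return leafpos t -> 'I_(nleaves t) with
  | leaf => fun _ => ord0
  | node k ts => fun l =>
      @tagnat.Rank k (fun i => nleaves (ts i)) (projT1 l) (leaf_index (projT2 l))
  end.

Fixpoint leaf_at (t : tree) : 'I_(nleaves t) -> leafpos t :=
  match t return 'I_(nleaves t) -> leafpos t with
  | leaf => fun _ => tt
  | node k ts => fun j =>
      let s := @tagnat.sig k (fun i => nleaves (ts i)) j in
      existT _ (tag s) (leaf_at (tagged s))
  end.

Lemma leaf_indexK t : cancel (@leaf_at t) (@leaf_index t).
Proof.
elim: t => [|k ts IH] j /=; first by rewrite (ord1 j).
by rewrite IH -[RHS]tagnat.sigK tagnat.sigE12.
Qed.

Lemma leaf_atK t : cancel (@leaf_index t) (@leaf_at t).
Proof.
elim: t => [|k ts IH] l /=; first by case: l.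
by case: l => i l /=; rewrite /tagnat.Rank tagnat.rankK /= IH.
Qed.

(* The objects of TR(n). *)
Record TR (n : nat) : Type := MkTR {
  tr_tree :> tree;
  tr_leaves : nleaves tr_tree == n
}.

Lemma TR_inj n (s t : TR n) : s = t :> tree -> s = t.
Proof.
by case: s t => [s hs] [t ht] /= e; subst t; rewrite (bool_irrelevance hs ht).
Qed.

(* [lidx l] is the number, in 'I_n, of the leaf [l] of a tree in TR(n), and
   [lat t i] is the [i]-th leaf of [t]. *)
Definition lidx n (t : TR n) (l : leafpos t) : 'I_n :=
  cast_ord (eqP (tr_leaves t)) (leaf_index l).

Definition lat n (t : TR n) (i : 'I_n) : leafpos t :=
  leaf_at (cast_ord (esym (eqP (tr_leaves t))) i).

Lemma lidxK n (t : TR n) : cancel (lat t) (@lidx n t).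
Proof. by move=> i; rewrite /lidx /lat leaf_indexK cast_ordKV. Qed.

Lemma latK n (t : TR n) : cancel (@lidx n t) (lat t).
Proof. by move=> l; rewrite /lidx /lat cast_ordK leaf_atK. Qed.

Fixpoint graft (t : tree) : (leafpos t -> tree) -> tree :=
  match t return (leafpos t -> tree) -> tree with
  | leaf => fun us => us tt
  | node k ts => fun us =>
      node (fun i => graft (fun l : leafpos (ts i) => us (lsub l)))
  end.

(* The tree t[s_v]: the i-th input of the root vertex of [t] is the i-th leaf of
   the tree substituted for that vertex. *)
Fixpoint tsubst (t : tree) : (forall v : vertex t, TR (arity v)) -> tree :=
  match t return (forall v : vertex t, TR (arity v)) -> tree with
  | leaf => fun _ => leaf
  | node k ts => fun s =>
      graft (fun l : leafpos (s None) =>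
        tsubst (fun w : vertex (ts (lidx l)) => s (vsub w)))
  end.

(* A family indexed by the vertices of a grafted tree, from families on its
   constituents; similarly [subst_fam] for a substituted tree t[s_v], whose
   vertices are the pairs of a vertex v of t and a vertex of s_v. These, and the
   restrictions below, are defined by recursion on trees so that no transport
   along equalities between arities is needed. *)
Fixpoint graft_fam (P : nat -> Type) (t : tree) :
    forall us : leafpos t -> tree,
    (forall v : vertex t, P (arity v)) ->
    (forall l (w : vertex (us l)), P (arity w)) ->
    forall u : vertex (graft us), P (arity u) :=
  match t return
    forall us : leafpos t -> tree,
    (forall v : vertex t, P (arity v)) ->
    (forall l (w : vertex (us l)), P (arity w)) ->
    forall u : vertex (graft us), P (arity u)
  with
  | leaf => fun us _ g => g tt
  | node k ts => fun us f g =>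
      node_rect (ts := fun i => graft (fun l : leafpos (ts i) => us (lsub l)))
        (P := fun u => P (arity u)) (f None)
        (fun i => graft_fam (us := fun l => us (lsub l))
           (fun v => f (vsub v))
                    (fun l => g (lsub l)))
  end.

Fixpoint subst_fam (P : nat -> Type) (t : tree) :
    forall s : (forall v : vertex t, TR (arity v)),
    (forall v (w : vertex (s v)), P (arity w)) ->
    forall u : vertex (tsubst s), P (arity u) :=
  match t return
    forall s : (forall v : vertex t, TR (arity v)),
    (forall v (w : vertex (s v)), P (arity w)) ->
    forall u : vertex (tsubst s), P (arity u)
  with
  | leaf => fun _ _ u => match u with end
  | node k ts => fun s f =>
      graft_fam (f None)
        (fun l => subst_fam (fun v => f (vsub v)))
  end.

(* Conversely, [graft_resl], [graft_resr] and [subst_res] restrict a family on a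
   grafted or substituted tree to its constituents. The type R of the members
   of the family may depend on another family f, already given on the
   constituents. *)
Fixpoint graft_resl (Q : nat -> Type) (R : forall k, Q k -> Type) (t : tree) :
    forall (us : leafpos t -> tree)
      (f : forall v : vertex t, Q (arity v))
      (g : forall l (w : vertex (us l)), Q (arity w)),
    (forall u, R (arity u) (graft_fam f g u)) -> forall v, R (arity v) (f v) :=
  match t return
    forall (us : leafpos t -> tree)
      (f : forall v : vertex t, Q (arity v))
      (g : forall l (w : vertex (us l)), Q (arity w)),
    (forall u, R (arity u) (graft_fam f g u)) -> forall v, R (arity v) (f v)
  with
  | leaf => fun _ _ _ _ v => match v with end
  | node k ts => fun us f g y =>
      node_rect (P := fun v => R (arity v) (f v)) (y None)
        (fun i => graft_resl (us := fun l => us (lsub l))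
                    (f := fun v => f (vsub v))
                    (g := fun l => g (lsub l))
                    (fun u => y (vsub u)))
  end.

Fixpoint graft_resr (Q : nat -> Type) (R : forall k, Q k -> Type) (t : tree) :
    forall (us : leafpos t -> tree)
      (f : forall v : vertex t, Q (arity v))
      (g : forall l (w : vertex (us l)), Q (arity w)),
    (forall u, R (arity u) (graft_fam f g u)) -> forall l w, R (arity w) (g l w) :=
  match t return
    forall (us : leafpos t -> tree)
      (f : forall v : vertex t, Q (arity v))
      (g : forall l (w : vertex (us l)), Q (arity w)),
    (forall u, R (arity u) (graft_fam f g u)) -> forall l w, R (arity w) (g l w)
  with
  | leaf => fun us f g y l =>
      match l as l0 return forall w, R (arity w) (g l0 w) with tt => y end
  | node k ts => fun us f g y l =>
      match l as l0 return forall w, R (arity w) (g l0 w) with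
      | existT i l' =>
          graft_resr (us := fun l => us (lsub l))
            (f := fun v => f (vsub v))
            (g := fun l => g (lsub l))
            (fun u => y (vsub u)) (l := l')
      end
  end.

Fixpoint subst_res (Q : nat -> Type) (R : forall k, Q k -> Type) (t : tree) :
    forall (s : forall v : vertex t, TR (arity v))
      (f : forall v (w : vertex (s v)), Q (arity w)),
    (forall u, R (arity u) (subst_fam f u)) -> forall v w, R (arity w) (f v w) :=
  match t return
    forall (s : forall v : vertex t, TR (arity v))
      (f : forall v (w : vertex (s v)), Q (arity w)),
    (forall u, R (arity u) (subst_fam f u)) -> forall v w, R (arity w) (f v w)
  with
  | leaf => fun _ _ _ v => match v with end
  | node k ts => fun s f y =>
      node_rect (P := fun v => forall w, R (arity w) (f v w)) (graft_resl y)
        (fun i =>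
          match lidxK (s None) i in _ = i0
            return forall (v : vertex (ts i0)) w,
                     R (arity w) (f (vsub v) w)
          with
          | erefl => subst_res (graft_resr y (l := lat (s None) i))
          end)
  end.

(* Versions of [graft_fam] and [subst_fam] for families whose type depends on
   another family. *)
Fixpoint graft_famd (Q : nat -> Type) (R : forall k, Q k -> Type) (t : tree) :
    forall (us : leafpos t -> tree)
      (f : forall v : vertex t, Q (arity v))
      (g : forall l (w : vertex (us l)), Q (arity w)),
    (forall v, R (arity v) (f v)) -> (forall l w, R (arity w) (g l w)) ->
    forall u, R (arity u) (graft_fam f g u) :=
  match t return
    forall (us : leafpos t -> tree)
      (f : forall v : vertex t, Q (arity v))
      (g : forall l (w : vertex (us l)), Q (arity w)),
    (forall v, R (arity v) (f v)) -> (forall l w, R (arity w) (g l w)) ->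
    forall u, R (arity u) (graft_fam f g u)
  with
  | leaf => fun _ _ _ _ y => y tt
  | node k ts => fun us f g x y =>
      node_rect (ts := fun i => graft (fun l : leafpos (ts i) => us (lsub l)))
        (P := fun u => R (arity u) (graft_fam f g u)) (x None)
        (fun i => graft_famd (us := fun l => us (lsub l)) (g := fun l => g (lsub l))
                    (fun v => x (vsub v)) (fun l => y (lsub l)))
  end.

Fixpoint subst_famd (Q : nat -> Type) (R : forall k, Q k -> Type) (t : tree) :
    forall (s : forall v : vertex t, TR (arity v))
      (f : forall v (w : vertex (s v)), Q (arity w)),
    (forall v w, R (arity w) (f v w)) -> (forall u, R (arity u) (subst_fam f u)) :=
  match t return
    forall (s : forall v : vertex t, TR (arity v))
      (f : forall v (w : vertex (s v)), Q (arity w)),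
    (forall v w, R (arity w) (f v w)) -> (forall u, R (arity u) (subst_fam f u))
  with
  | leaf => fun _ _ _ u => match u with end
  | node k ts => fun s f y =>
      graft_famd (y None) (fun l => subst_famd (fun v => y (vsub v)))
  end.

Lemma nleaves_graft t (us : leafpos t -> tree) :
  nleaves (graft us) = \sum_(j < nleaves t) nleaves (us (leaf_at j)).
Proof.
elim: t us => [|k ts IH] us /=; first by rewrite big_ord1.
under eq_bigr => i _ do rewrite IH.
rewrite (sig_big_dep (fun _ => true) (fun _ _ => true)
  (fun i j => nleaves (us (lsub (leaf_at (t := ts i) j))))) /=.
by rewrite (reindex _ (@tagnat.sig_bij_on k (fun i => nleaves (ts i)))).
Qed.

Lemma nleaves_tsubst t (s : forall v : vertex t, TR (arity v)) :
  nleaves (tsubst s) = nleaves t.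
Proof.
elim: t s => [|k ts IH] s //=.
rewrite nleaves_graft.
rewrite (eq_bigr (fun j => nleaves (ts (lidx (t := s None) (leaf_at j))))); last first.
  by move=> j _; rewrite IH.
under eq_bigr => j _ do rewrite /lidx leaf_indexK.
have e := eqP (tr_leaves (s None)); rewrite /= in e.
rewrite (reindex (cast_ord (esym e))) /=.
  by apply: eq_bigr => i _; congr (nleaves (ts _)); apply: val_inj.
by exists (cast_ord e) => i _; rewrite ?cast_ordK ?cast_ordKV.
Qed.

Definition Tsubst n (t : TR n) (s : forall v : vertex t, TR (arity v)) : TR n.
Proof.
exists (tsubst s); rewrite nleaves_tsubst; exact: tr_leaves.
Defined.

Lemma graft_leaves n (t : TR n) (k : 'I_n -> nat) (us : forall i, TR (k i)) :
  nleaves (graft (fun l : leafpos t => us (lidx l))) = \sum_(i < n) k i.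
Proof.
rewrite nleaves_graft.
under eq_bigr => j _ do rewrite (eqP (tr_leaves _)) /lidx leaf_indexK.
have e := eqP (tr_leaves t).
rewrite (reindex (cast_ord (esym e))) /=.
  by apply: eq_bigr => i _; congr (k _); apply: val_inj.
by exists (cast_ord e) => i _; rewrite ?cast_ordK ?cast_ordKV.
Qed.

Definition Graft n (t : TR n) (k : 'I_n -> nat) (us : forall i, TR (k i)) :
    TR (\sum_(i < n) k i) :=
  MkTR (introT eqP (graft_leaves t us)).

Definition triv : TR 1 := MkTR (tr_tree := leaf) (eqxx 1).

Lemma corolla_leaves k : nleaves (node (fun _ : 'I_k => leaf)) == k.
Proof. by rewrite /= sum_nat_const card_ord muln1. Qed.

Definition corolla k : TR k := MkTR (corolla_leaves k).

Definition corolla_rect k (P : vertex (corolla k) -> Type) (p : P None) v : P v :=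
  match v with
  | None => p
  | Some (existT i w) => match w with end
  end.

(* Pairs of a tree and a family on its vertices: proofs compare families on
   provably equal trees as elements of this type. *)
Definition tfam P := {t : tree & forall v : vertex t, P (arity v)}.
Definition mktfam P t f : tfam P := existT (fun t => forall v : vertex t, P (arity v)) t f.

Definition pnode P k (p : P k) (c : 'I_k -> tfam P) : tfam P :=
  mktfam (t := node (fun i => projT1 (c i)))
    (node_rect (P := fun v => P (arity v)) p (fun i => projT2 (c i))).

Lemma mktfam_node P k (ts : 'I_k -> tree) (f : forall v : vertex (node ts), P (arity v)) :
  mktfam f = pnode (f None) (fun i => mktfam (fun v => f (vsub (i := i) v))).
Proof.
congr existT; apply: functional_extensionality_dep => -[[i w]|] //.
Qed.

Lemma mktfam_ext P k (ts ts' : 'I_k -> tree)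
  (f : forall v : vertex (node ts), P (arity v)) (f' : forall v : vertex (node ts'), P (arity v)) :
  f None = f' None ->
  (forall i, mktfam (fun v => f (vsub (i := i) v)) = mktfam (fun v => f' (vsub (i := i) v))) ->
  mktfam f = mktfam f'.
Proof.
move=> e0 e1; rewrite 2!mktfam_node e0; congr pnode; exact: functional_extensionality_dep.
Qed.

Lemma mktfam_graft P t t' (us : leafpos t -> tree) (us' : leafpos t' -> tree) f f'
  (g : forall l (w : vertex (us l)), P (arity w)) (g' : forall l (w : vertex (us' l)), P (arity w))
  (e : t = t') :
  mktfam f = mktfam f' -> (forall l, mktfam (g l) = mktfam (g' (eq_rect _ leafpos l _ e))) ->
  mktfam (graft_fam f g) = mktfam (graft_fam f' g').
Proof.
case: t' / e us' f' g' => us' f' g' ef eg.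
have {}ef : f = f'.
  have := projT2_eq ef; rewrite (Prop_irrelevance (projT1_eq ef) erefl); exact.
subst f'.
pose c l := mktfam (g l); pose c' l := mktfam (g' l).
have ec : c = c' by apply: functional_extensionality_dep => l; exact: eg.
change (mktfam (graft_fam f (fun l => projT2 (c l))) = mktfam (graft_fam f (fun l => projT2 (c' l)))).
by rewrite ec.
Qed.

Lemma mktfam_graft1 P t (us us' : leafpos t -> tree) f
  (g : forall l (w : vertex (us l)), P (arity w)) (g' : forall l (w : vertex (us' l)), P (arity w)) :
  (forall l, mktfam (g l) = mktfam (g' l)) ->
  mktfam (graft_fam f g) = mktfam (graft_fam f g').
Proof. by move=> e; apply: (mktfam_graft (e := erefl)). Qed.

Fixpoint gleaf t : forall (us : leafpos t -> tree) l, leafpos (us l) -> leafpos (graft us) :=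
  match t return forall (us : leafpos t -> tree) l, leafpos (us l) -> leafpos (graft us) with
  | leaf => fun us l => match l with tt => id end
  | node k ts => fun us l =>
    match l as l0 return leafpos (us l0) -> leafpos (graft us) with
    existT i l' => fun x => @lsub k (fun i => graft (fun l : leafpos (ts i) => us (lsub l))) i (gleaf (us := fun l => us (lsub l)) x) end
  end.
Fixpoint ungleaf t : forall (us : leafpos t -> tree), leafpos (graft us) -> {l : leafpos t & leafpos (us l)} :=
  match t return forall (us : leafpos t -> tree), leafpos (graft us) -> {l : leafpos t & leafpos (us l)} with
  | leaf => fun us x => existT (fun l => leafpos (us l)) tt x
  | node k ts => fun us x =>
     match x with existT i x' =>
       let p := ungleaf (us := fun l => us (lsub l)) x' in
       existT (fun l => leafpos (us l)) (lsub (projT1 p)) (projT2 p)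
     end
  end.
Lemma ungleafK t (us : leafpos t -> tree) l (x : leafpos (us l)) : 
  ungleaf (gleaf x) = existT (fun l => leafpos (us l)) l x.
Proof.
elim: t us l x => [|k ts IH] us /=; first by case.
by case=> i l x /=; rewrite IH.
Qed.
Lemma gleafK t (us : leafpos t -> tree) x : gleaf (projT2 (ungleaf (us := us) x)) = x.
Proof.
elim: t us x => [|k ts IH] us //=.
case=> i x /=; rewrite IH //.
Qed.

Lemma graft_famA P t (us : leafpos t -> tree) (vs : leafpos (graft us) -> tree) 
  (f : forall v : vertex t, P (arity v)) (g : forall l (v : vertex (us l)), P (arity v))
  (h : forall l (v : vertex (vs l)), P (arity v)) :
  mktfam (graft_fam (graft_fam f g) h) = mktfam (graft_fam f (fun l => graft_fam (g l) (fun l' => h (gleaf l')))).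
Proof.
elim: t us vs f g h => [|k ts IH] us vs f g h //=.
apply: mktfam_ext => // i /=.
exact: (IH i (fun l => us (lsub l)) (fun l => vs (lsub (ts := fun i => graft (fun l : leafpos (ts i) => us (lsub l))) l))
  (fun v => f (vsub v)) (fun l => g (lsub l))
  (fun l => h (lsub (ts := fun i => graft (fun l : leafpos (ts i) => us (lsub l))) l))).
Qed.

Lemma ltn_Rank k (p : 'I_k -> nat) (i i' : 'I_k) (j : 'I_(p i)) (j' : 'I_(p i')) :
  i < i' -> tagnat.Rank _ j < tagnat.Rank _ j'.
Proof.
move=> lt; rewrite ltnNge; apply/negP => /(@tagnat.le_sig1 _ _ _ _).
by rewrite !tagnat.Rank1K => h; move: lt; rewrite ltnNge => /negP; apply.
Qed.

Lemma ltn_Rank2 k (p : 'I_k -> nat) (i : 'I_k) (j j' : 'I_(p i)) :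
  j < j' -> tagnat.Rank _ j < tagnat.Rank _ j'.
Proof.
move=> h; rewrite ltnNge; apply/negP => hh.
have := tagnat.le_Rank (p_ := p) (i := i) j' j.
rewrite [(tagnat.Rank i j' <= tagnat.Rank i j)%O]hh => /esym.
by change ((j' <= j) = true -> False); rewrite leqNgt h.
Qed.

Lemma gleaf_lt1 t (us : leafpos t -> tree) l m (x : leafpos (us l)) (y : leafpos (us m)) :
  leaf_index l < leaf_index m -> leaf_index (gleaf x) < leaf_index (gleaf y).
Proof.
elim: t us l m x y => [|k ts IH] us; first by case; case.
case=> i l [i' m] x y /= lt.
case: (ltngtP i i') => [h|h|h].
- exact: ltn_Rank.
- by have := ltn_Rank (p := fun i => nleaves (ts i)) (leaf_index m) (leaf_index l) h; rewrite ltnNge (ltnW lt).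
have {}h := val_inj h; subst i'.
apply: ltn_Rank2; apply: IH.
rewrite ltnNge; apply/negP => hh; move: lt; rewrite ltnNge => /negP; apply.
by move: hh; rewrite leq_eqVlt => /orP[/eqP/val_inj->|
  /(@ltn_Rank2 k (fun i => nleaves (ts i)))/ltnW].
Qed.

Lemma gleaf_lt2 t (us : leafpos t -> tree) l (x y : leafpos (us l)) :
  leaf_index x < leaf_index y -> leaf_index (gleaf x) < leaf_index (gleaf y).
Proof.
elim: t us l x y => [|k ts IH] us; first by case.
by case=> i l x y h /=; apply: ltn_Rank2; apply: IH.
Qed.

Fixpoint sleaf t : forall s : (forall v : vertex t, TR (arity v)), leafpos (tsubst s) -> leafpos t :=
  match t return forall s : (forall v : vertex t, TR (arity v)), leafpos (tsubst s) -> leafpos t with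
  | leaf => fun _ => id
  | node k ts => fun s x =>
     let p := ungleaf x in lsub (sleaf (projT2 p))
  end.

Lemma leaf_index_inj t (x y : leafpos t) : leaf_index x = leaf_index y :> nat -> x = y.
Proof. by move/val_inj => e; rewrite -(leaf_atK x) e leaf_atK. Qed.

Lemma sleaf_lt t (s : forall v : vertex t, TR (arity v)) (x y : leafpos (tsubst s)) :
  leaf_index x < leaf_index y -> leaf_index (sleaf x) < leaf_index (sleaf y).
Proof.
elim: t s x y => [|k ts IH] s; first by [].
pose us := fun l : leafpos (s None) =>
  tsubst (fun w : vertex (ts (lidx l)) => s (vsub w)).
move=> x y; rewrite -(gleafK x) -(gleafK y).
case: (ungleaf x) (ungleaf y) => l {}x [m {}y] /= lt.
rewrite !ungleafK /=.
case: (ltngtP (leaf_index l) (leaf_index m)) => h.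
- exact: ltn_Rank.
- by have := gleaf_lt1 (us := us) y x h; rewrite ltnNge (ltnW lt).
have {}h := leaf_index_inj h; subst m.
apply: ltn_Rank2; apply: IH.
case: (ltngtP (leaf_index x) (leaf_index y)) => // h.
- by have := gleaf_lt2 (us := us) h; rewrite ltnNge (ltnW lt).
by move: lt; rewrite (leaf_index_inj h) ltnn.
Qed.

Lemma homo_ord_id n (f : nat -> nat) : (forall i, i < n -> f i < n) ->
  (forall i j, i < j -> j < n -> f i < f j) -> forall i, i < n -> f i = i.
Proof.
move=> fn fm.
have le1 i : i < n -> i <= f i.
  elim: i => // i IH h; apply: leq_ltn_trans (IH (ltnW h)) _; exact: fm.
have le2 d i : i + d.+1 = n -> f i <= i.
  elim: d i => [|d IH] i e.
    by have := fn i; rewrite -e addn1 ltnS; apply.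
  rewrite -ltnS; apply: (leq_trans (fm i i.+1 _ _)) => //.
    by rewrite -e !addnS !ltnS leq_addr.
  by apply: IH; rewrite -e !addnS addSn.
move=> i h; apply/eqP; rewrite eqn_leq le1 // (le2 (n - i.+1)) //.
by rewrite addnS -addSn subnKC.
Qed.

Lemma sleaf_index t (s : forall v : vertex t, TR (arity v)) (x : leafpos (tsubst s)) :
  leaf_index (sleaf x) = leaf_index x :> nat.
Proof.
pose e := nleaves_tsubst s.
pose f (i : nat) : nat := if insub i is Some j then leaf_index (sleaf (s := s) (leaf_at (cast_ord (esym e) j))) else i.
have fE (i : nat) (h : i < nleaves t) : f i = leaf_index (sleaf (s := s) (leaf_at (cast_ord (esym e) (Ordinal h)))).
  by rewrite /f insubT.
have := @homo_ord_id (nleaves t) f _ _ (leaf_index x).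
have hx : leaf_index x < nleaves t by have := ltn_ord (leaf_index x); rewrite {2}e.
move=> /(_ _ _ hx); rewrite (fE _ hx).
suff -> : leaf_at (cast_ord (esym e) (Ordinal hx)) = x.
  apply.
    by move=> i h; rewrite (fE _ h).
  move=> i j ij hj; rewrite (fE _ hj) (fE _ (ltn_trans ij hj)).
  by apply: sleaf_lt; rewrite !leaf_indexK.
by apply: leaf_index_inj; rewrite leaf_indexK.
Qed.

Definition fvert (P : nat -> Type) (k : nat) (s : TR k) := forall v : vertex s, P (arity v).

Lemma subst_fam_graft P Q (T : forall k, Q k -> TR k) (L : forall k (q : Q k), fvert P (T k q))
   t (us : leafpos t -> tree)
   (f : forall v : vertex t, Q (arity v))
   (g : forall l (w : vertex (us l)), Q (arity w)) :
  mktfam (subst_fam (s := fun u => T _ (graft_fam f g u)) (fun u => L _ (graft_fam f g u))) =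
  mktfam (graft_fam (us := fun l' => tsubst (fun w => T _ (g (sleaf l') w)))
    (subst_fam (fun v => L _ (f v))) (fun l' => subst_fam (fun w => L _ (g (sleaf l') w)))).
Proof.
elim: t us f g => [|k ts IH] us f g //=.
rewrite graft_famA; apply: mktfam_graft1 => l; rewrite /= (IH (lidx l)) /=.
by apply: mktfam_graft1 => l' /=; rewrite ungleafK.
Qed.

Lemma lidx_sleaf n (t : TR n) (s : forall v : vertex t, TR (arity v)) (l : leafpos (Tsubst s)) :
  lidx l = lidx (sleaf (s := s) l).
Proof. by apply: val_inj; rewrite /= sleaf_index. Qed.

Lemma subst_famA P Q (T : forall k, Q k -> TR k) (L : forall k (q : Q k), fvert P (T k q))
   t (s : forall v : vertex t, TR (arity v))
   (f : forall v (w : vertex (s v)), Q (arity w)) :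
  mktfam (subst_fam (s := fun u => T _ (subst_fam f u)) (fun u => L _ (subst_fam f u))) =
  mktfam (subst_fam (s := fun v => Tsubst (fun w => T _ (f v w)))
            (fun v => subst_fam (fun w => L _ (f v w)))).
Proof.
elim: t s f => [|k ts IH] s f //=.
rewrite (subst_fam_graft L); apply: mktfam_graft1 => l.
by rewrite IH -(@lidx_sleaf _ (s None) (fun w => T _ (f None w))).
Qed.

Lemma lidx_corolla k (i : 'I_k) :
  lidx (t := corolla k) (lsub (ts := fun _ => leaf) (i := i) tt) = i.
Proof.
have h j : @tagnat.Rank k (fun _ => 1) j ord0 < k.
  have := ltn_ord (@tagnat.Rank k (fun _ => 1) j ord0).
  by rewrite {2}sum_nat_const card_ord muln1.
apply: val_inj => /=; rewrite -[RHS](@homo_ord_id k (fun j =>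
  if insub j is Some j' then @tagnat.Rank k (fun _ => 1) j' ord0 else j)) //.
- rewrite (insubT (fun j => j < k) (ltn_ord i)) (_ : Sub _ _ = i) //; exact: val_inj.
- by move=> j hj; rewrite insubT.
- move=> j j' jj' hj'; rewrite insubT ?(ltn_trans jj') // => hj.
  by rewrite insubT; apply: ltn_Rank.
Qed.

Lemma subst_fam1 P t (F : forall v : vertex t, fvert P (corolla (arity v))) :
  mktfam (subst_fam F) = mktfam (fun v => F v None).
Proof.
elim: t F => [|k ts IH] F; first by congr existT; apply: functional_extensionality_dep; case.
apply: mktfam_ext => // i /=.
rewrite IH; suff -> : lidx (t := corolla k) (lsub (i := i) (tt : leafpos leaf)) = i by [].
exact: lidx_corolla.
Qed.

Lemma graft_fam1 P t (f : forall v : vertex t, P (arity v)) 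
  (g : forall (l : leafpos t) (w : vertex leaf), P (arity w)) :
  mktfam (graft_fam f g) = mktfam f.
Proof.
elim: t f g => [|k ts IH] f g; first by congr existT; apply: functional_extensionality_dep; case.
by apply: mktfam_ext => // i /=; rewrite IH.
Qed.

Lemma existT_inj (A : Type) (B : A -> Type) (a : A) (x y : B a) :
  existT B a x = existT B a y -> x = y.
Proof.
move=> e; have := projT2_eq e.
by rewrite (Prop_irrelevance (projT1_eq e) erefl).
Qed.

Lemma eq_fam t (B : vertex t -> Type) (f g : forall v, B v) : (forall v, f v = g v) -> f = g.
Proof. exact: functional_extensionality_dep. Qed.

Lemma graft_res_eq (Q : nat -> Type) (R : forall k, Q k -> Type) (t : tree)
   (us : leafpos t -> tree) (f : forall v : vertex t, Q (arity v))
   (g : forall l (w : vertex (us l)), Q (arity w))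
   (y : forall u, R (arity u) (graft_fam f g u)) u :
  graft_fam (P := fun k => {q : Q k & R k q})
    (fun v => existT (R (arity v)) (f v) (graft_resl y v))
    (fun l w => existT (R (arity w)) (g l w) (graft_resr y w)) u
  = existT (R (arity u)) (graft_fam f g u) (y u).
Proof.
elim: t us f g y u => [|k ts IH] us f g y u //=.
case: u => [[i u]|] //=; exact: (IH i _ _ _ (fun u => y (vsub u))).
Qed.

Lemma lidx_inj n (t : TR n) (l l' : leafpos t) : lidx l = lidx l' -> l = l'.
Proof. by move=> e; rewrite -(latK (t := t) l) e latK. Qed.

Lemma subst_res_eq (Q : nat -> Type) (R : forall k, Q k -> Type) (t : tree)
   (s : forall v : vertex t, TR (arity v))
   (f : forall v (w : vertex (s v)), Q (arity w))
   (y : forall u, R (arity u) (subst_fam f u)) u :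
  subst_fam (P := fun k => {q : Q k & R k q})
    (fun v w => existT (R (arity w)) (f v w) (subst_res y w)) u
  = existT (R (arity u)) (subst_fam f u) (y u).
Proof.
elim: t s f y u => [|k ts IH] s f y u /=; first by case: u.
rewrite -(graft_res_eq y u); congr (graft_fam _ _ u).
apply: functional_extensionality_dep => l.
apply: functional_extensionality_dep => w.
rewrite -(IH (lidx l) _ _ (graft_resr y (l := l))).
congr (subst_fam _ w); apply: functional_extensionality_dep => v.
apply: functional_extensionality_dep => w'; congr existT; rewrite /subst_res -/subst_res /=.
move: (lidxK (s None) (lidx l)); rewrite latK => e.
by rewrite (Prop_irrelevance e erefl).
Qed.

Lemma subst_res_map (Q : nat -> Type) (R R' : forall k, Q k -> Type)
   (phi : forall k q, R k q -> R' k q) (t : tree)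
   (s : forall v : vertex t, TR (arity v))
   (f : forall v (w : vertex (s v)), Q (arity w))
   (y : forall u, R (arity u) (subst_fam f u)) v w :
  subst_res (R := R') (fun u => phi _ _ (y u)) w = phi _ _ (subst_res y (v := v) w).
Proof.
have gL t' (us : leafpos t' -> tree) (f' : forall v : vertex t', Q (arity v))
   (g : forall l (w : vertex (us l)), Q (arity w))
   (y' : forall u, R (arity u) (graft_fam f' g u)) v' :
   graft_resl (R := R') (fun u => phi _ _ (y' u)) v' = phi _ _ (graft_resl y' v').
  elim: t' us f' g y' v' => [|k ts IH] us f' g y'; first by case.
  case=> [[i v']|] //=; exact: (IH i _ _ _ (fun u => y' (vsub u))).
have gR t' (us : leafpos t' -> tree) (f' : forall v : vertex t', Q (arity v))
   (g : forall l (w : vertex (us l)), Q (arity w))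
   (y' : forall u, R (arity u) (graft_fam f' g u)) l w' :
   graft_resr (R := R') (fun u => phi _ _ (y' u)) w' = phi _ _ (graft_resr y' (l := l) w').
  elim: t' us f' g y' l w' => [|k ts IH] us f' g y'; first by case.
  case=> i l w' /=; exact: (IH i _ _ _ (fun u => y' (vsub u))).
elim: t s f y v w => [|k ts IH] s f y; first by case.
case=> [[i v]|] w; last exact: gL.
move: v w; rewrite /=; move: (lidxK (s None) i); move: (lat (s None) i) => l e.
case: _ / e => v w.
apply: etrans (IH (lidx l) (fun v => s (vsub v)) (fun v => f (vsub v))
  (graft_resr (R := R) y (l := l)) v w).
have -> : graft_resr (R := R') (fun u => phi _ _ (y u)) (l := l) =
  (fun w => phi _ _ (graft_resr (R := R) y (l := l) w)) by apply: eq_fam => u; exact: gR.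
by [].
Qed.

Lemma subst_famd_eq (Q : nat -> Type) (R : forall k, Q k -> Type) (t : tree)
   (s : forall v : vertex t, TR (arity v))
   (f : forall v (w : vertex (s v)), Q (arity w))
   (h : forall v w, R (arity w) (f v w)) u :
  subst_fam (P := fun k => {q : Q k & R k q}) (fun v w => existT (R (arity w)) (f v w) (h v w)) u
  = existT (R (arity u)) (subst_fam f u) (subst_famd h u).
Proof.
have gE t' (us : leafpos t' -> tree) (f' : forall v : vertex t', Q (arity v))
   (g : forall l (w : vertex (us l)), Q (arity w)) x y u' :
   graft_fam (P := fun k => {q : Q k & R k q})
    (fun v => existT (R (arity v)) (f' v) (x v))
    (fun l w => existT (R (arity w)) (g l w) (y l w)) u'
   = existT (R (arity u')) (graft_fam f' g u') (graft_famd x y u').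
  elim: t' us f' g x y u' => [|k ts IH] us f' g x y u' //=.
  case: u' => [[i u']|] //=; exact: IH.
elim: t s f h u => [|k ts IH] s f h u /=; first by case: u.
rewrite -gE; congr (graft_fam _ _ u).
by apply: functional_extensionality_dep => l; apply: eq_fam => w; rewrite IH.
Qed.

Lemma subst_fam_map (P Q : nat -> Type) (phi : forall k, P k -> Q k) (t : tree)
   (s : forall v : vertex t, TR (arity v))
   (f : forall v (w : vertex (s v)), P (arity w)) u :
  subst_fam (fun v w => phi _ (f v w)) u = phi _ (subst_fam f u).
Proof.
have gE t' (us : leafpos t' -> tree) (f' : forall v : vertex t', P (arity v))
   (g : forall l (w : vertex (us l)), P (arity w)) u' :
   graft_fam (fun v => phi _ (f' v)) (fun l w => phi _ (g l w)) u' = phi _ (graft_fam f' g u').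
  elim: t' us f' g u' => [|k ts IH] us f' g u' //=.
  case: u' => [[i u']|] //=; exact: IH.
elim: t s f u => [|k ts IH] s f u /=; first by case: u.
rewrite -gE; congr (graft_fam _ _ u).
by apply: functional_extensionality_dep => l; apply: eq_fam => w; rewrite IH.
Qed.

Lemma subst_fam_inj (P : nat -> Type) (t : tree)
   (s : forall v : vertex t, TR (arity v))
   (f g : forall v (w : vertex (s v)), P (arity w)) :
  (forall u, subst_fam f u = subst_fam g u) -> forall v w, f v w = g v w.
Proof.
move=> e v w.
apply: (subst_res (Q := fun k => (P k * P k)%type) (R := fun k q => q.1 = q.2)
         (f := fun v w => (f v w, g v w))) => u.
by rewrite -(subst_fam_map (fun k q => q.1)) -(subst_fam_map (fun k q => q.2)) /=.
Qed.

(* [subst_res] for a family whose type depends on the arities only. *)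
Definition subst_res0 (P : nat -> Type) t (s : forall v : vertex t, TR (arity v))
    (y : forall u : vertex (tsubst s), P (arity u)) v (w : vertex (s v)) : P (arity w) :=
  subst_res (Q := fun _ => unit) (R := fun k _ => P k) (f := fun _ _ => tt) y w.

Lemma subst_res0K P t (s : forall v : vertex t, TR (arity v))
    (y : forall u : vertex (tsubst s), P (arity u)) : subst_fam (subst_res0 y) = y.
Proof.
apply: eq_fam => u.
have := subst_res_eq (Q := fun _ => unit) (R := fun k _ => P k) (f := fun _ _ => tt) y u.
pose snd k (z : {_ : unit & P k}) : P k := projT2 z.
move/(congr1 (snd _)); rewrite /= => <-.
by rewrite -(subst_fam_map snd).
Qed.

Lemma mktfam_tree P t t' f f' : @mktfam P t f = @mktfam P t' f' -> t = t'.
Proof. by move/(congr1 (@projT1 _ _)). Qed.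

(* Maps t' -> t in TR(n); note that the family is indexed by the vertices of the
   target [t]. *)
Record trmap n (t' t : TR n) : Type := MkTrmap {
  tm_fam :> forall v : vertex t, TR (arity v);
  tm_eq : Tsubst tm_fam = t'
}.

Lemma trid_eq n (t : TR n) : Tsubst (fun v : vertex t => corolla (arity v)) = t.
Proof.
apply: TR_inj => /=; exact: (mktfam_tree (subst_fam1 (P := fun _ => unit) (fun _ _ => tt))).
Qed.

Definition trid n (t : TR n) : trmap t t := MkTrmap (trid_eq t).

Lemma TsubstA n (t : TR n) (s : forall v : vertex t, TR (arity v))
  (r : forall v (w : vertex (s v)), TR (arity w)) :
  Tsubst (t := Tsubst s) (subst_fam r) = Tsubst (fun v => Tsubst (r v)).
Proof.
apply: TR_inj => /=.
exact: (mktfam_tree (subst_famA (P := fun _ => unit) (T := fun k t => t) (fun _ _ _ => tt) r)).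
Qed.

(* The family p', regarded as a family on the vertices of t[p] = t'. *)
Definition trpull n (t'' t' t : TR n) (p : trmap t' t) (p' : trmap t'' t') :
    forall u : vertex (Tsubst p), TR (arity u) :=
  match esym (tm_eq p) in _ = t0 return forall u : vertex t0, TR (arity u) with
  | erefl => p'
  end.

Arguments trpull {n t'' t' t} p p'.

Lemma trcomp_eq n (t'' t' t : TR n) (p : trmap t' t) (p' : trmap t'' t') :
  Tsubst (fun v => Tsubst (subst_res0 (trpull p p') (v := v))) = t''.
Proof.
rewrite -TsubstA subst_res0K.
case: p p' => p e p'; rewrite /trpull /=; case: t' / e p' => p' /=; exact: tm_eq.
Qed.

Definition trcomp n (t'' t' t : TR n) (p : trmap t' t) (p' : trmap t'' t') : trmap t'' t :=
  MkTrmap (trcomp_eq p p').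

Lemma Tsubst_map_eq n (t : TR n) (s s' : forall v : vertex t, TR (arity v))
  (p : forall v, trmap (s' v) (s v)) : Tsubst (t := Tsubst s) (subst_fam (fun v => p v)) = Tsubst s'.
Proof.
by rewrite TsubstA; congr Tsubst; apply: eq_fam => v; apply: tm_eq.
Qed.
Definition Tsubst_map n (t : TR n) (s s' : forall v : vertex t, TR (arity v))
  (p : forall v, trmap (s' v) (s v)) : trmap (Tsubst s') (Tsubst s) :=
  MkTrmap (Tsubst_map_eq p).

Definition Graft_fam n (t' t : TR n) (k : 'I_n -> nat) (us' us : forall i, TR (k i))
  (p : trmap t' t) (ps : forall i, trmap (us' i) (us i)) :
    forall u : vertex (Graft t us), TR (arity u) :=
  graft_fam p (fun l => ps (lidx l)).

Lemma Graft_map_eq n (t' t : TR n) (k : 'I_n -> nat) (us' us : forall i, TR (k i))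
  (p : trmap t' t) (ps : forall i, trmap (us' i) (us i)) :
  Tsubst (Graft_fam p ps) = Graft t' us'.
Proof.
apply: TR_inj => /=.
have := mktfam_tree (subst_fam_graft (P := fun _ => unit) (T := fun k t => t) (fun _ _ _ => tt)
  (us := fun l => us (lidx l)) p (fun l => ps (lidx l))); rewrite /= => ->.
case: p => p e; case: t' / e => /=.
congr graft; apply: functional_extensionality_dep => l.
rewrite -(congr1 (@tr_tree _) (tm_eq (ps (lidx (t := Tsubst p) l)))) /=.
by rewrite -(lidx_sleaf (t := t) (s := p) l).
Qed.

Definition Graft_map n (t' t : TR n) (k : 'I_n -> nat) (us' us : forall i, TR (k i))
  (p : trmap t' t) (ps : forall i, trmap (us' i) (us i)) :
  trmap (Graft t' us') (Graft t us) := MkTrmap (Graft_map_eq p ps).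

(* In [edge (node ts)], [None] is the root edge; the inputs of the root vertex
   are the root edges of the [ts i]. *)
Fixpoint edge (t : tree) : Type :=
  match t with
  | leaf => unit
  | node k ts => option {i : 'I_k & edge (ts i)}
  end.

Definition esub k (ts : 'I_k -> tree) i (e : edge (ts i)) : edge (node ts) :=
  Some (existT (fun i => edge (ts i)) i e).

Definition root_edge (t : tree) : edge t :=
  match t return edge t with
  | leaf => tt
  | node k ts => None
  end.

Fixpoint leaf_edge (t : tree) : leafpos t -> edge t :=
  match t return leafpos t -> edge t with
  | leaf => fun _ => tt
  | node k ts => fun l => esub (leaf_edge (projT2 l))
  end.

Fixpoint out_edge (t : tree) : vertex t -> edge t :=
  match t return vertex t -> edge t with
  | leaf => fun v => match v with end
  | node k ts => fun v =>
      match v with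
      | None => None
      | Some (existT i w) => esub (out_edge w)
      end
  end.

Fixpoint in_edge (t : tree) : forall v : vertex t, 'I_(arity v) -> edge t :=
  match t return forall v : vertex t, 'I_(arity v) -> edge t with
  | leaf => fun v => match v with end
  | node k ts =>
      node_rect (P := fun v => 'I_(arity v) -> edge (node ts))
        (fun j => esub (root_edge (ts j)))
        (fun i w j => esub (in_edge (v := w) j))
  end.

(* The edge labelling of a grafted or substituted tree. Edges lying in two
   constituents get the same label from both when the boundary labels match,
   as is required in [labsubst]. *)
Fixpoint graft_lab (A : Type) (t : tree) :
    forall us : leafpos t -> tree,
    (edge t -> A) -> (forall l, edge (us l) -> A) -> edge (graft us) -> A :=
  match t return
    forall us : leafpos t -> tree,
    (edge t -> A) -> (forall l, edge (us l) -> A) -> edge (graft us) -> A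
  with
  | leaf => fun _ _ m => m tt
  | node k ts => fun us b m e =>
      match e with
      | None => b None
      | Some (existT i e') =>
          graft_lab (fun e => b (esub e)) (fun l => m (lsub l)) e'
      end
  end.

Fixpoint subst_lab (A : Type) (t : tree) :
    forall s : (forall v : vertex t, TR (arity v)),
    (edge t -> A) -> (forall v, edge (s v) -> A) -> edge (tsubst s) -> A :=
  match t return
    forall s : (forall v : vertex t, TR (arity v)),
    (edge t -> A) -> (forall v, edge (s v) -> A) -> edge (tsubst s) -> A
  with
  | leaf => fun _ b _ => b
  | node k ts => fun s b m =>
      graft_lab (m None)
        (fun l => subst_lab (fun e => b (esub (i := lidx l) e)) (fun v => m (vsub v)))
  end.

(* Edge-labelled trees with leaves labelled x_0, ..., x_{n-1} and root edge
   labelled a. *)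
Record labtree (A : Type) n (x : 'I_n -> A) (a : A) : Type := MkLabtree {
  lb_tree :> TR n;
  lb_lab : edge lb_tree -> A;
  lb_leaves : forall l, lb_lab (leaf_edge l) = x (lidx l);
  lb_root : lb_lab (root_edge lb_tree) = a
}.

Arguments lb_lab {A n x a} _ _.

(* The labels of the input edges and of the output edge of a vertex. *)
Definition ins A t (b : edge t -> A) (v : vertex t) : 'I_(arity v) -> A :=
  fun i => b (in_edge i).
Arguments ins [A t] b v i /.
Definition out A t (b : edge t -> A) (v : vertex t) : A := b (out_edge v).
Arguments out [A t] b v /.

Lemma graft_lab_leaf A t (us : leafpos t -> tree) (b : edge t -> A) (m : forall l, edge (us l) -> A)
  l (x : leafpos (us l)) : graft_lab b m (leaf_edge (gleaf x)) = m l (leaf_edge x).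
Proof.
elim: t us b m l x => [|k ts IH] us b m /=; first by case.
case=> i l x; exact: (IH i _ _ (fun l => m (lsub l))).
Qed.

Lemma graft_lab_root A t (us : leafpos t -> tree) (b : edge t -> A) (m : forall l, edge (us l) -> A) :
  (forall l, m l (root_edge (us l)) = b (leaf_edge l)) ->
  graft_lab b m (root_edge (graft us)) = b (root_edge t).
Proof. by case: t us b m => [|k ts] us b m //= /(_ tt). Qed.

Lemma subst_lab_root A t (s : forall v : vertex t, TR (arity v)) (b : edge t -> A)
    (m : forall v, edge (s v) -> A) :
  (forall v l, m v (leaf_edge l) = ins b v (lidx l)) ->
  (forall v, m v (root_edge (s v)) = out b v) ->
  subst_lab b m (root_edge (tsubst s)) = b (root_edge t).
Proof.
elim: t s b m => [|k ts IH] s b m hl hr //=.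
rewrite graft_lab_root; first exact: (hr None).
move=> l; rewrite (IH (lidx l)); first by rewrite (hl None).
  by move=> v l'; exact: (hl (vsub v)).
by move=> v; exact: (hr (vsub v)).
Qed.

Lemma subst_lab_leaf A t (s : forall v : vertex t, TR (arity v)) (b : edge t -> A)
    (m : forall v, edge (s v) -> A) (l : leafpos (tsubst s)) :
  subst_lab b m (leaf_edge l) = b (leaf_edge (sleaf l)).
Proof.
elim: t s b m l => [|k ts IH] s b m l /=; first by case: l.
rewrite -{1}(gleafK l) (graft_lab_leaf (us := fun l => tsubst (fun w : vertex (ts (lidx l)) => s (vsub w)))).
exact: IH.
Qed.

(* Substitution of edge-labelled trees with matching boundary labels for the
   vertices of an edge-labelled tree. *)
Section Lsubst.
Variables (A : Type) (n : nat) (x : 'I_n -> A) (a : A) (D : labtree x a).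
Variable s : forall v : vertex D, labtree (ins (lb_lab D) v) (out (lb_lab D) v).

Lemma labsubst_leaves (l : leafpos (Tsubst s)) :
  subst_lab (lb_lab D) (fun v => lb_lab (s v)) (leaf_edge l) = x (lidx l).
Proof. by rewrite subst_lab_leaf lb_leaves -lidx_sleaf. Qed.
Lemma labsubst_root :
  subst_lab (lb_lab D) (fun v => lb_lab (s v)) (root_edge (Tsubst s)) = a.
Proof.
rewrite subst_lab_root ?lb_root // => v; last exact: lb_root.
move=> l; exact: lb_leaves.
Qed.
Definition labsubst : labtree x a :=
  MkLabtree (lb_tree := Tsubst s) labsubst_leaves labsubst_root.
End Lsubst.

Definition clab A k (x : 'I_k -> A) (a : A) : edge (corolla k) -> A :=
  fun e => match e with None => a | Some (existT i _) => x i end.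

Lemma clab_leaves A k (x : 'I_k -> A) a l : clab x a (leaf_edge l) = x (lidx (t := corolla k) l).
Proof.
by case: l => i []; rewrite (lidx_corolla i).
Qed.

Definition labcorolla A k (x : 'I_k -> A) (a : A) : labtree x a :=
  MkLabtree (clab_leaves x a) (erefl a).

Definition labtriv A (a : A) : labtree (fun _ : 'I_1 => a) a :=
  @MkLabtree A 1 _ a triv (fun _ => a) (fun _ => erefl) erefl.

(* The concatenation of n finite sequences. *)
Definition concat A n (k : 'I_n -> nat) (x : forall i, 'I_(k i) -> A) :
    'I_(\sum_(i < n) k i) -> A :=
  fun j => x (tagnat.sig1 j) (tagnat.sig2 j).

Lemma concat_Rank A n (k : 'I_n -> nat) (x : forall i, 'I_(k i) -> A) i (j : 'I_(k i)) :
  concat x (tagnat.Rank i j) = x i j.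
Proof.
pose g (p : {i : 'I_n & 'I_(k i)}) := x (tag p) (tagged p).
by rewrite -[LHS]/(g (tagnat.sig (tagnat.Rank i j))) /tagnat.Rank tagnat.rankK.
Qed.

Lemma Rank_val n (p q : 'I_n -> nat) i (j : 'I_(p i)) (j' : 'I_(q i)) :
  p = q -> j = j' :> nat -> tagnat.Rank i j = tagnat.Rank i j' :> nat.
Proof. by move=> e; case: q / e j' => j' /val_inj ->. Qed.

(* The two-level tree: a root vertex with n inputs, the i-th of which is the
   output of a vertex with k i inputs, all of them leaves. *)
Section TwoLevel.
Variables (n : nat) (k : 'I_n -> nat).
Lemma twolevel_leaves : nleaves (node (fun i : 'I_n => corolla (k i))) == \sum_(i < n) k i.
Proof. by apply/eqP; apply: eq_bigr => i _; exact: (eqP (tr_leaves (corolla (k i)))). Qed.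
Definition twolevel : TR (\sum_(i < n) k i) := MkTR twolevel_leaves.

Definition twolevel_rect (P : vertex twolevel -> Type) (p0 : P None)
    (p1 : forall i, P (vsub (ts := fun i => corolla (k i)) (i := i) None)) : forall v, P v :=
  node_rect p0 (fun i => corolla_rect (p1 i)).

Lemma lidx_twolevel i (j : 'I_(k i)) :
  lidx (t := twolevel) (lsub (lsub (ts := fun _ => leaf) (i := j) tt)) = tagnat.Rank i j.
Proof.
apply: val_inj => /=; apply: Rank_val.
  by apply/funext => i'; apply: (eqP (tr_leaves (corolla (k i')))).
exact: (congr1 val (lidx_corolla j)).
Qed.

Variables (A : Type) (x : forall i, 'I_(k i) -> A) (b : 'I_n -> A) (a : A).
Definition twolab : edge twolevel -> A :=
  fun e => match e with
  | None => a
  | Some (existT i e') => clab (@x i) (b i) e'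
  end.
Lemma twolab_leaves l : twolab (leaf_edge l) = concat (@x) (lidx l).
Proof. by case: l => i [j []]; rewrite lidx_twolevel concat_Rank. Qed.
Definition labtwolevel : labtree (concat (@x)) a :=
  MkLabtree (lb_tree := twolevel) twolab_leaves (erefl a).
End TwoLevel.

(* Trees whose vertices v are labelled by elements of X over the arity of v. *)
Record ltree (X : nat -> Type) n : Type := MkLtree {
  lt_tree :> TR n;
  lt_lab : forall v : vertex lt_tree, X (arity v)
}.
Arguments lt_lab {X n} l v.

Definition lcorolla (X : nat -> Type) n (x : X n) : ltree X n :=
  MkLtree (lt_tree := corolla n) (corolla_rect (P := fun v => X (arity v)) x).

Definition lsubst X n (T : TR n) (S : forall v : vertex T, ltree X (arity v)) : ltree X n :=
  MkLtree (lt_tree := Tsubst (fun v => S v)) (subst_fam (fun v => lt_lab (S v))).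

(* The arrows into x, each packed with its domain. Equality in this type is
   equality of arrows, and entails equality of the domains; it is used below
   wherever the domains of the two sides are only provably equal. *)
Definition into (ob : nat -> Type) (hom : forall n, ltree ob n -> ob n -> Type) n (x : ob n) : Type :=
  {T : ltree ob n & hom n T x}.

Record T2multicategory : Type := MkT2 {
  ob : nat -> Type;
  hom : forall n, ltree ob n -> ob n -> Type;
  idm : forall n (x : ob n), hom (lcorolla x) x;
  compm : forall n (T : ltree ob n) (x : ob n), hom T x ->
    forall g : (forall v : vertex T, into hom (lt_lab T v)),
    hom (lsubst (fun v => projT1 (g v))) x;
  comp1m : forall n (x : ob n) (f : into hom x),
    existT (fun T => hom T x) _
      (@compm n (lcorolla x) x (idm x)
        (corolla_rect
           (P := fun v => @into ob hom (arity v) (lt_lab (lcorolla x) v)) f)) = f;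
  compm1 : forall n (T : ltree ob n) (x : ob n) (f : hom T x),
    existT (fun T => hom T x) _
      (compm f (fun v => existT (fun S => hom S (lt_lab T v)) _ (idm (lt_lab T v)))) =
    existT (fun T => hom T x) _ f;
  compA : forall n (T : ltree ob n) (x : ob n) (f : hom T x)
      (g : forall v : vertex T, into hom (lt_lab T v))
      (h : forall v (w : vertex (projT1 (g v))), into hom (lt_lab (projT1 (g v)) w)),
    existT (fun T => hom T x) _ (compm (compm f g) (subst_famd h)) =
    existT (fun T => hom T x) _ (compm f (fun v =>
      existT (fun S => hom S (lt_lab T v)) _ (compm (projT2 (g v)) (h v))))
}.

(* Functors TR(n)^op -> Set. *)
Record psh n : Type := MkPsh {
  pob :> TR n -> Type;
  pact : forall t t' : TR n, trmap t' t -> pob t -> pob t';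
  pact1 : forall t (a : pob t), pact (trid t) a = a;
  pactM : forall t t' t'' (p : trmap t' t) (p' : trmap t'' t') (a : pob t),
    pact (trcomp p p') a = pact p' (pact p a)
}.

Record Vhom n (T : ltree psh n) (F : psh n) : Type := MkVhom {
  vapp : forall t : (forall v : vertex T, TR (arity v)),
    (forall v, lt_lab T v (t v)) -> F (Tsubst t);
  vapp_nat : forall (t t' : forall v : vertex T, TR (arity v))
      (p : forall v, trmap (t' v) (t v)) (y : forall v, lt_lab T v (t v)),
    pact (Tsubst_map p) (vapp y) = vapp (fun v => pact (p v) (y v))
}.

(* Transport along an equality of trees. *)
Definition pcast n (F : psh n) (t t' : TR n) (e : t = t') : F t -> F t' :=
  fun a => eq_rect t (pob F) a t' e.

Definition pelt n (F : psh n) := {t : TR n & F t}.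

Lemma pcastE n (F : psh n) (t t' : TR n) (e : t = t') (a : F t) :
  existT F t' (pcast e a) = existT F t a.
Proof. by case: t' / e. Qed.

Lemma pact_pack n (F : psh n) (t1 t1' t2 t2' : TR n) (p1 : trmap t1' t1) (p2 : trmap t2' t2)
    (a1 : F t1) (a2 : F t2) :
  mktfam p1 = mktfam p2 -> existT F t1 a1 = existT F t2 a2 ->
  existT F t1' (pact p1 a1) = existT F t2' (pact p2 a2).
Proof.
move=> ep ea.
move: (projT1_eq ea) (projT2_eq ea) => /= e.
case: t2 / e a2 p2 ep ea => a2 p2 ep _ /= ->.
have {}ep := existT_inj ep.
case: p1 p2 ep => p1 e1 [p2 e2] /= ep; subst p2.
by case: t1' / e1; case: t2' / e2.
Qed.

Lemma Vid_eq n (t : forall v : vertex (corolla n), TR (arity v)) : t None = Tsubst t.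
Proof.
apply: TR_inj; rewrite /=; apply: esym.
exact: (mktfam_tree (graft_fam1 (P := fun _ => unit) (fun _ => tt) (fun _ _ => tt))).
Qed.

Definition Vid n (F : psh n) : Vhom (lcorolla F) F.
Proof.
refine (@MkVhom n (lcorolla F) F (fun t y => pcast (Vid_eq t) (y None)) _).
move=> t t' p y; apply: (@existT_inj _ (pob F)); rewrite pcastE.
apply: pact_pack; last exact: pcastE.
rewrite /=; exact: graft_fam1.
Defined.

Section Vcomp.
Variables (n : nat) (T : ltree psh n) (F : psh n) (f : Vhom T F).
Variable g : forall v : vertex T, into Vhom (lt_lab T v).
Let L := lsubst (fun v => projT1 (g v)).

Definition Vres (t : forall u : vertex L, TR (arity u)) (y : forall u, lt_lab L u (t u)) :
    forall v (w : vertex (projT1 (g v))), pelt (lt_lab (projT1 (g v)) w) :=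
  subst_res (R := pelt) (fun u => existT _ (t u) (y u)).

Lemma Vcomp_eq (t : forall u : vertex L, TR (arity u)) (y : forall u, lt_lab L u (t u)) :
  Tsubst (fun v => Tsubst (fun w => projT1 (Vres y (v := v) w))) = Tsubst t.
Proof.
rewrite -TsubstA; congr Tsubst; apply: eq_fam => u.
pose phi k (z : {F : psh k & pelt F}) := projT1 (projT2 z).
have := subst_res_eq (R := pelt) (fun u => existT _ (t u) (y u)) u.
by move/(congr1 (phi _)); rewrite -subst_fam_map.
Qed.

(* The composite of the functions f and g_v, up to the identification
   T[(T_v)[t_{v,w}]] = (T[T_v])[t_u]. *)
Definition Vcomp_app (t : forall u : vertex L, TR (arity u)) (y : forall u, lt_lab L u (t u)) :
    F (Tsubst t) :=
  pcast (Vcomp_eq y)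
    (vapp f (t := fun v => Tsubst (fun w => projT1 (Vres y (v := v) w)))
       (fun v => vapp (projT2 (g v)) (fun w => projT2 (Vres y (v := v) w)))).

Definition Vcomp : Vhom L F.
Proof.
refine (MkVhom (vapp := Vcomp_app) _) => t t' p y.
pose N k (G : psh k) := {t' : TR k & {t : TR k & {p : trmap t' t & G t}}}.
pose src k (G : psh k) (z : N k G) : pelt G :=
  existT G (projT1 (projT2 z)) (projT2 (projT2 (projT2 z))).
pose tgt k (G : psh k) (z : N k G) : pelt G :=
  existT G (projT1 z) (pact (projT1 (projT2 (projT2 z))) (projT2 (projT2 (projT2 z)))).
pose q u : N _ (lt_lab L u) := existT _ (t' u) (existT _ (t u) (existT _ (p u) (y u))).
pose qz := subst_res (R := N) q.
have ey : Vres y = fun v w => src _ _ (qz v w).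
  by apply: eq_fam => v; apply: eq_fam => w; exact: (subst_res_map src q).
have ey' : Vres (fun u => pact (p u) (y u)) = fun v w => tgt _ _ (qz v w).
  by apply: eq_fam => v; apply: eq_fam => w; exact: (subst_res_map tgt q).
apply: (@existT_inj _ (pob F)); rewrite /Vcomp_app pcastE.
move: (Vcomp_eq y); rewrite ey ey' /= => e.
pose pz v := Tsubst_map (fun w => projT1 (projT2 (projT2 (qz v w)))).
transitivity (existT F _ (pact (Tsubst_map pz) (vapp f (fun v => vapp (projT2 (g v)) (fun w => projT2 (src _ _ (qz v w))))))).
  apply: pact_pack; last exact: pcastE.
  rewrite /=.
  pose Q k := {G : psh k & N k G}.
  have qE : subst_fam (P := Q) (fun v w => existT (N _) (lt_lab (projT1 (g v)) w) (qz v w)) = fun u => existT (N _) (lt_lab L u) (q u).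
    by apply: eq_fam => u; exact: (subst_res_eq (R := N) q).
  have := @subst_famA TR Q (fun k z => projT1 (projT2 (projT2 z))) (fun k z => tm_fam (projT1 (projT2 (projT2 (projT2 z))))) _ _ (fun v w => existT (N _) (lt_lab (projT1 (g v)) w) (qz v w)).
  by rewrite qE.
rewrite vapp_nat; congr existT; congr vapp.
by apply: eq_fam => v; rewrite vapp_nat.
Defined.
End Vcomp.

Definition labelt k := {G : psh k & pelt G}.
Definition mklabelt k (G : psh k) (z : pelt G) : labelt k := existT (@pelt k) G z.

Lemma mktfam_inj P t (f f' : forall v : vertex t, P (arity v)) : mktfam f = mktfam f' -> f = f'.
Proof. exact: existT_inj. Qed.

Definition Vap n (T : ltree psh n) (F : psh n) (f : Vhom T F) (z : forall v, pelt (lt_lab T v)) : pelt F :=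
  existT F (Tsubst (fun v => projT1 (z v))) (vapp f (fun v => projT2 (z v))).

Lemma Vhom_ext n (T : ltree psh n) (F : psh n) (f f' : Vhom T F) :
  (forall z, Vap f z = Vap f' z) -> f = f'.
Proof.
case: f f' => [f nf] [f' nf'] e.
have ef : f = f'.
  apply: functional_extensionality_dep => t; apply: functional_extensionality_dep => y.
  exact: (existT_inj (e (fun v => existT _ (t v) (y v)))).
by case: _ / ef nf' {e} => nf'; rewrite (Prop_irrelevance nf nf').
Qed.

Lemma Vinto_ext n (F : psh n) (A B : into Vhom F) :
  mktfam (lt_lab (projT1 A)) = mktfam (lt_lab (projT1 B)) ->
  (forall z z', mktfam (fun v => mklabelt (z v)) = mktfam (fun v => mklabelt (z' v)) ->
     Vap (projT2 A) z = Vap (projT2 B) z') ->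
  A = B.
Proof.
case: A B => [[T1 X1] f1] [[T2 X2] f2] /= eX e.
have eT : T1 = T2 by apply: TR_inj; apply: (mktfam_tree eX).
subst T2; have {}eX := mktfam_inj eX; subst X2.
congr existT; apply: Vhom_ext => z; exact: e.
Qed.

Lemma Vap_comp n (T : ltree psh n) (F : psh n) (f : Vhom T F)
  (g : forall v : vertex T, into Vhom (lt_lab T v)) z :
  Vap (Vcomp f g) z = Vap f (fun v => Vap (projT2 (g v)) (fun w => subst_res (R := pelt) z w)).
Proof.
rewrite /Vap /= pcastE /Vres.
have -> // : (fun u => existT (lt_lab (lsubst (fun v => projT1 (g v))) u) (projT1 (z u)) (projT2 (z u))) = z.
by apply: eq_fam => u; case: (z u).
Qed.

Lemma Vap_id n (F : psh n) z : Vap (Vid F) z = z None.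
Proof. by rewrite /Vap /= pcastE; case: (z None). Qed.

Lemma mklabelt_inj n (T : ltree psh n) (z z' : forall v, pelt (lt_lab T v)) :
  mktfam (fun v => mklabelt (z v)) = mktfam (fun v => mklabelt (z' v)) -> z = z'.
Proof.
move=> /mktfam_inj e; apply: eq_fam => v.
exact: (existT_inj (congr1 (fun h => h v) e)).
Qed.

Lemma lsubst_pack n (T : TR n) (S : forall v : vertex T, ltree psh (arity v))
  (z : forall u, pelt (lt_lab (lsubst S) u)) :
  (fun u => mklabelt (z u)) = subst_fam (fun v w => mklabelt (subst_res (R := pelt) z (v := v) w)).
Proof. apply: eq_fam => u; exact: esym (subst_res_eq (R := pelt) z u). Qed.

Lemma Vcomp1m n (F : psh n) (f : into Vhom F) :
  existT (fun T => Vhom T F) _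
    (Vcomp (Vid F) (corolla_rect
        (P := fun v => @into psh Vhom (arity v) (lt_lab (lcorolla F) v)) f)) = f.
Proof.
apply: Vinto_ext; first by exact: graft_fam1.
move=> z z' e; rewrite Vap_comp Vap_id /=.
congr Vap; apply: mklabelt_inj; rewrite -e lsubst_pack.
exact: esym (graft_fam1 _ _).
Qed.

Lemma Vcompm1 n (T : ltree psh n) (F : psh n) (f : Vhom T F) :
  existT (fun T => Vhom T F) _
    (Vcomp f (fun v => existT (fun S => Vhom S (lt_lab T v)) _ (Vid (lt_lab T v)))) =
  existT (fun T => Vhom T F) _ f.
Proof.
apply: Vinto_ext; first by exact: subst_fam1.
move=> z z' e; rewrite Vap_comp /=.
congr Vap; apply: mklabelt_inj; rewrite -e lsubst_pack.
apply: esym; apply: etrans (subst_fam1 _) _ => /=; congr mktfam.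
by apply: eq_fam => v; rewrite Vap_id.
Qed.

Lemma subst_famd_ex (Q : nat -> Type) (S : forall k, Q k -> Type) (R : forall k q, S k q -> Type) t
  (s : forall v : vertex t, TR (arity v))
  (f : forall v (w : vertex (s v)), Q (arity w))
  (h : forall v w, S (arity w) (f v w))
  (a : forall u, R (arity u) (subst_fam f u) (subst_famd h u)) :
  exists z : forall v w, R (arity w) (f v w) (h v w),
   (fun u => existT (fun q => {x : S _ q & R _ q x}) (subst_fam f u) (existT (R _ _) (subst_famd h u) (a u)))
   = subst_fam (P := fun k => {q : Q k & {x : S k q & R k q x}})
       (fun v w => existT (fun q => {x : S _ q & R _ q x}) (f v w) (existT (R _ _) (h v w) (z v w))).
Proof.
pose Q' k := {q : Q k & S k q}.
pose R' k (q : Q' k) := R k (projT1 q) (projT2 q).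
pose f' v w : Q' _ := existT (S _) (f v w) (h v w).
have E u : existT (S _) (subst_fam f u) (subst_famd h u) = subst_fam (P := Q') f' u by rewrite -subst_famd_eq.
pose a' u : R' _ (subst_fam f' u) := 
  eq_rect (existT (S _) (subst_fam f u) (subst_famd h u)) (R' _) (a u) _ (E u).
exists (subst_res (R := R') a'); apply: eq_fam => u.
pose phi k (x : {q : Q' k & R' k q}) : {q : Q k & {x : S k q & R k q x}} :=
  existT (fun q => {x : S k q & R k q x}) (projT1 (projT1 x)) (existT (R k _) (projT2 (projT1 x)) (projT2 x)).
rewrite -[LHS]/(phi _ (existT (R' _) (existT (S _) (subst_fam f u) (subst_famd h u)) (a u : R' _ (existT _ _ _)))).
have -> : existT (R' _) (existT (S _) (subst_fam f u) (subst_famd h u)) (a u : R' _ (existT _ _ _)) = existT (R' _) (subst_fam (P := Q') f' u) (a' u).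
  by rewrite /a'; case: _ / (E u).
by rewrite -(subst_res_eq (R := R') a' u) -subst_fam_map.
Qed.

Lemma VcompA n (T : ltree psh n) (F : psh n) (f : Vhom T F)
      (g : forall v : vertex T, into Vhom (lt_lab T v))
      (h : forall v (w : vertex (projT1 (g v))), into Vhom (lt_lab (projT1 (g v)) w)) :
    existT (fun T => Vhom T F) _ (Vcomp (Vcomp f g) (subst_famd h)) =
    existT (fun T => Vhom T F) _ (Vcomp f (fun v =>
      existT (fun S => Vhom S (lt_lab T v)) _ (Vcomp (projT2 (g v)) (h v)))).
Proof.
pose Q k := {G : psh k & into Vhom G}.
have sE : subst_fam (P := Q) (fun v w => existT (@into _ _ _) (lt_lab (projT1 (g v)) w) (h v w)) =
    fun u => existT (@into _ Vhom _) (subst_fam (fun v => lt_lab (projT1 (g v))) u) (subst_famd h u).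
  by apply: eq_fam => u; rewrite subst_famd_eq.
apply: Vinto_ext.
  have := @subst_famA psh Q (fun k z => lt_tree (projT1 (projT2 z)))
    (fun k z => lt_lab (projT1 (projT2 z))) _ _
    (fun v w => existT (@into _ _ _) (lt_lab (projT1 (g v)) w) (h v w)).
  by rewrite sE.
move=> z z' e; rewrite !Vap_comp.
pose R k (G : psh k) (A : into Vhom G) := forall t : vertex (projT1 A), pelt (lt_lab (projT1 A) t).
pose Q3 k := {G : psh k & {A : into Vhom G & R k G A}}.
have [y ey] := @subst_famd_ex psh (fun k G => into Vhom G) R _ _ _ h (subst_res (R := pelt) z).
have ez' : (fun v w => subst_res (R := pelt) (subst_res (R := pelt) z' (v := v)) (v := w)) = y.
  have := @subst_famA labelt Q3 (fun k z => lt_tree (projT1 (projT1 (projT2 z))))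
    (fun k z => fun t => mklabelt (projT2 (projT2 z) t)) _ _
    (fun v w => existT (fun q => {x : into Vhom q & R _ q x}) (lt_lab (projT1 (g v)) w) (existT (R _ _) (h v w) (y v w))).
  rewrite -ey /= => H.
  have := etrans (congr1 (@mktfam labelt _) (lsubst_pack z)) H.
  rewrite e => {}H.
  have e2 := mktfam_inj (etrans (esym (congr1 (@mktfam labelt _) (lsubst_pack z'))) H).
  apply: eq_fam => v; apply: eq_fam => w; apply: eq_fam => t.
  have e3 := subst_fam_inj (fun u => congr1 (fun h => h u) e2) (v := v).
  have {}e3 : (fun w : vertex (lsubst (fun w => projT1 (h v w))) => mklabelt (subst_res (R := pelt) z' (v := v) w)) = subst_fam (fun w t => mklabelt (y v w t)).
    by apply: eq_fam => w'; exact: e3.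
  rewrite lsubst_pack in e3.
  have := subst_fam_inj (fun u => congr1 (fun h => h u) e3) (v := w) t.
  exact: existT_inj.
congr Vap; apply: eq_fam => v; rewrite Vap_comp; congr Vap; apply: eq_fam => w.
have -> : subst_res (R := pelt) (subst_res (R := pelt) z' (v := v)) (v := w) = y v w by rewrite -ez'.
apply: (@existT_inj _ (@pelt _)).
apply: (subst_fam_inj (f := fun v w => mklabelt (subst_res (R := pelt) (f := fun v w => lt_lab (projT1 (g v)) w) (fun u => Vap (projT2 (subst_famd h u)) (fun t => subst_res (R := pelt) z t)) (v := v) w))
  (g := fun v w => mklabelt (Vap (projT2 (h v w)) (y v w)))) => u.
rewrite (subst_res_eq (R := pelt)).
pose phi k (x : Q3 k) : labelt k := mklabelt (Vap (projT2 (projT1 (projT2 x))) (projT2 (projT2 x))).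
have := congr1 (fun h => phi _ (h u)) ey.
by move=> e4; apply: etrans e4 (esym (subst_fam_map phi _ u)).
Qed.

(* The T_2-multicategory [TR^op, Set]. *)
Definition presheaf_T2 : T2multicategory :=
  MkT2 Vcomp1m Vcompm1 VcompA.

(* Plain multicategories enriched in V, with object set C0. *)
Record enriched (V : T2multicategory) (C0 : Type) : Type := MkEnriched {
  eC : forall n, ('I_n -> C0) -> C0 -> ob V n;
  kappa : forall n (x : 'I_n -> C0) (a : C0) (D : labtree x a),
    hom (MkLtree (lt_tree := D) (fun v => eC (ins (lb_lab D) v) (out (lb_lab D) v)))
        (eC x a);
  kappa_subst : forall n (x : 'I_n -> C0) (a : C0) (D : labtree x a)
      (Ds : forall v : vertex D, labtree (ins (lb_lab D) v) (out (lb_lab D) v)),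
    existT (fun T => hom T (eC x a)) _ (kappa (labsubst Ds)) =
    existT (fun T => hom T (eC x a)) _
      (compm (kappa D)
         (fun v => existT (fun S => hom S (eC (ins (lb_lab D) v) (out (lb_lab D) v))) _
                     (kappa (Ds v))));
  kappa_corolla : forall n (x : 'I_n -> C0) (a : C0),
    existT (fun T => hom T (eC x a)) _ (kappa (labcorolla x a)) =
    existT (fun T => hom T (eC x a)) _ (idm (eC x a))
}.

Record relaxed_data (C0 : Type) : Type := MkRelaxedData {
  rC : forall n, TR n -> ('I_n -> C0) -> C0 -> Type;
  ract : forall n (t t' : TR n) (p : trmap t' t) (x : 'I_n -> C0) (a : C0),
    rC t x a -> rC t' x a;
  rcomp : forall n (t : TR n) (k : 'I_n -> nat) (ts : forall i, TR (k i))
      (x : forall i, 'I_(k i) -> C0) (b : 'I_n -> C0) (a : C0),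
    (forall i, rC (ts i) (x i) (b i)) -> rC t b a -> rC (Graft t ts) (concat x) a;
  rid : forall a : C0, rC triv (fun _ => a) a
}.

(* Elements of the sets C_t(x; a), for all n, t and x: the two sides of the
   associativity and identity laws lie over trees and label sequences that are
   only provably equal. *)
Definition relt C0 (C : relaxed_data C0) (a : C0) : Type :=
  {n : nat & {t : TR n & {x : 'I_n -> C0 & rC C t x a}}}.

Definition mkrelt C0 (C : relaxed_data C0) n (t : TR n) (x : 'I_n -> C0) (a : C0)
    (f : rC C t x a) : relt C a :=
  existT _ n (existT _ t (existT _ x f)).

Record relaxed_laws C0 (C : relaxed_data C0) : Prop := {
  ract1 : forall n (t : TR n) (x : 'I_n -> C0) (a : C0) (f : rC C t x a),
    ract (trid t) f = f;
  ractM : forall n (t t' t'' : TR n) (p : trmap t' t) (p' : trmap t'' t')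
      (x : 'I_n -> C0) (a : C0) (f : rC C t x a),
    ract (trcomp p p') f = ract p' (ract p f);
  rcompA : forall n (t : TR n)
      (k : 'I_n -> nat) (ts : forall i, TR (k i))
      (m : forall i, 'I_(k i) -> nat) (us : forall i j, TR (m i j))
      (a : C0) (b : 'I_n -> C0) (c : forall i, 'I_(k i) -> C0)
      (d : forall i j, 'I_(m i j) -> C0)
      (f : rC C t b a) (g : forall i, rC C (ts i) (c i) (b i))
      (h : forall i j, rC C (us i j) (d i j) (c i j)),
    mkrelt (rcomp (fun i => rcomp (h i) (g i)) f) =
    mkrelt (rcomp (b := concat c) (fun s => h (tagnat.sig1 s) (tagnat.sig2 s)) (rcomp g f));
  rcomp1r : forall n (t : TR n) (b : 'I_n -> C0) (a : C0) (f : rC C t b a),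
    mkrelt (rcomp (fun i => rid C (b i)) f) = mkrelt f;
  rcomp1l : forall n (t : TR n) (x : 'I_n -> C0) (a : C0) (f : rC C t x a),
    mkrelt (rcomp (fun _ : 'I_1 => f) (rid C a)) = mkrelt f;
  rcomp_act : forall n (t t' : TR n) (k : 'I_n -> nat) (ts ts' : forall i, TR (k i))
      (p : trmap t' t) (ps : forall i, trmap (ts' i) (ts i))
      (x : forall i, 'I_(k i) -> C0) (b : 'I_n -> C0) (a : C0)
      (f : rC C t b a) (g : forall i, rC C (ts i) (x i) (b i)),
    ract (Graft_map p ps) (rcomp g f) = rcomp (fun i => ract (ps i) (g i)) (ract p f)
}.

Record relaxed (C0 : Type) : Type := MkRelaxed {
  rel_data :> relaxed_data C0;
  rel_laws : relaxed_laws rel_data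
}.

Section Underlying.
Variables (C0 : Type) (E : enriched presheaf_T2 C0).

Lemma twolevel_Tsubst n (t : TR n) (k : 'I_n -> nat) (ts : forall i, TR (k i)) :
  Tsubst (t := twolevel k)
    (twolevel_rect (P := fun v => TR (arity v)) t ts) = Graft t ts.
Proof.
apply: TR_inj => /=; congr graft; apply: functional_extensionality_dep => l.
exact: (mktfam_tree (graft_fam1 (P := fun _ => unit) (fun _ => tt) (fun _ _ => tt))).
Qed.

Lemma triv_Tsubst (s : forall v : vertex triv, TR (arity v)) : Tsubst s = triv.
Proof. exact: TR_inj. Qed.

(* [underlying_comp] and [underlying_id] are components of the arrows kappa_D for
   D the two-level tree and the trivial tree; [pcast] only identifies the tree
   obtained by substitution into D with t o (t_1, ..., t_n), respectively with
   the trivial tree. *)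
Definition underlying_comp n (t : TR n) (k : 'I_n -> nat) (ts : forall i, TR (k i))
    (x : forall i, 'I_(k i) -> C0) (b : 'I_n -> C0) (a : C0)
    (g : forall i, pob (eC E (x i) (b i)) (ts i)) (f : pob (eC E b a) t) :
    pob (eC E (concat x) a) (Graft t ts) :=
  let K : Vhom _ _ := kappa E (labtwolevel x b a) in
  pcast (twolevel_Tsubst t ts)
    (vapp K (t := twolevel_rect (P := fun v => TR (arity v)) t ts)
       (twolevel_rect
          (P := fun v : vertex (twolevel k) =>
             pob (eC E (ins (lb_lab (labtwolevel x b a)) v)
                       (out (lb_lab (labtwolevel x b a)) v))
               (twolevel_rect (P := fun v => TR (arity v)) t ts v))
          f g)).

Definition underlying_id (a : C0) : pob (eC E (fun _ : 'I_1 => a) a) triv :=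
  let K : Vhom _ _ := kappa E (labtriv a) in
  pcast (triv_Tsubst _)
    (vapp K (t := fun v : vertex triv => match v with end)
       (fun v : vertex triv => match v with end)).

Definition underlying : relaxed_data C0 :=
  @MkRelaxedData C0
    (fun n t x a => pob (eC E x a) t)
    (fun n t t' p x a f => pact p f)
    underlying_comp
    underlying_id.
End Underlying.

(* Main.v *)
Require Import Defs.
From mathcomp Require Import all_boot all_order.
From mathcomp Require Import boolp.

(** The operations of a relaxed multicategory evaluate every tree whose vertices
    carry elements f_v of C_{t_v}(ins v; out v) to an element of C_{T[t_v]}:
    compose the values of the subtrees with the element at the root. The laws of
    a relaxed multicategory say exactly that this evaluation commutes with
    grafting, hence with substitution, and is natural in the t_v; so the
    evaluation maps are the arrows kappa_D of an enriched multicategory.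
    Conversely, since every tree is an iterated graft of corollas and grafting is
    substitution into a two-level tree, closure of kappa under substitution shows
    that all kappa_D are the evaluation maps of the underlying operations.
    Associativity of these operations holds because both sides are values of
    kappa on the same three-level tree. *)

Set Implicit Arguments.
Unset Strict Implicit.
Unset Printing Implicit Defensive.

(** * Evaluation of trees in a relaxed multicategory *)

Section Cells.
Variables (C0 : Type) (C : relaxed_data C0).

(* An element packed with its boundary labels: families of cells on a tree can be
   compared and restricted without mentioning the edge labels of the tree. *)
Definition cell k : Type :=
  {x : 'I_k -> C0 & {a : C0 & {t : TR k & rC C t x a}}}.

Definition mkcell k (t : TR k) (x : 'I_k -> C0) (a : C0) (f : rC C t x a) : cell k :=
  existT _ x (existT _ a (existT _ t f)).

Definition cell_in k (c : cell k) : 'I_k -> C0 := projT1 c.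
Definition cell_out k (c : cell k) : C0 := projT1 (projT2 c).
Definition cell_tree k (c : cell k) : TR k := projT1 (projT2 (projT2 c)).
Definition cell_val k (c : cell k) : rC C (cell_tree c) (cell_in c) (cell_out c) :=
  projT2 (projT2 (projT2 c)).

(** The arity is packed as well: the number of leaves of a grafted or substituted tree equals the
    expected arity only provably. *)
Definition pcell (k : nat) (c : cell k) : {k & cell k} := existT cell k c.

Lemma mkcell_inj k (t : TR k) x a (f f' : rC C t x a) : mkcell f = mkcell f' -> f = f'.
Proof. by move=> e; exact: existT_inj (existT_inj (existT_inj e)). Qed.

Definition relt_cell a (r : relt C a) : {k & cell k} :=
  pcell (mkcell (projT2 (projT2 (projT2 r)))).

Lemma relt_cell_inj a : injective (@relt_cell a).
Proof.
pose phi (z : {k & cell k}) : {a & relt C a} :=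
  existT (relt C) (cell_out (projT2 z)) (mkrelt (cell_val (projT2 z))).
move=> r r' /(congr1 phi); case: r r' => [n [t [x f]]] [n' [t' [x' f']]].
exact: existT_inj.
Qed.

Definition pcomp k (c : cell k) (R : forall j, relt C (cell_in c j)) : relt C (cell_out c) :=
  mkrelt (rcomp (fun j => projT2 (projT2 (projT2 (R j)))) (cell_val c)).

(* A relation rather than a function: a family of cells need not be composable,
   and on the trivial tree it does not determine the label of the edge. *)
Fixpoint evaluates (t : tree) : (forall v : vertex t, cell (arity v)) -> cell (nleaves t) -> Prop :=
  match t return (forall v : vertex t, cell (arity v)) -> cell (nleaves t) -> Prop with
  | leaf => fun _ c => exists a, c = mkcell (rid C a)
  | node k ts => fun f c =>
      exists (T : TR k) (b : 'I_k -> C0) (a : C0) (p : rC C T b a)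
        (Ts : forall i, TR (nleaves (ts i))) (x : forall i, 'I_(nleaves (ts i)) -> C0)
        (q : forall i, rC C (Ts i) (x i) (b i)),
      [/\ f None = mkcell p, forall i, evaluates (fun v => f (vsub v)) (mkcell (q i)) &
          c = mkcell (rcomp q p)]
  end.

Definition pevaluates (F : tfam cell) (r : {k & cell k}) : Prop :=
  exists2 c, evaluates (projT2 F) c & r = pcell c.

(** The root cell fixes the input labels [b], hence the output labels of the values on the subtrees,
    as the induction requires. On the trivial tree the value is an identity, fixed by its label. *)
Lemma evaluates_inj t (f : forall v : vertex t, cell (arity v)) c c' :
  evaluates f c -> evaluates f c' -> cell_out c = cell_out c' -> c = c'.
Proof.
elim: t f c c' => [|k ts IH] f c c'; first by case=> a -> [a' ->]; rewrite /cell_out /= => ->.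
case=> T [b [a [p [Ts [x [q [e Eq ->]]]]]]] [T' [b' [a' [p' [Ts' [x' [q' [e' Eq' ->]]]]]]]] _.
have {e'} : mkcell p = mkcell p' by rewrite -e -e'.
move=> e1; move: (projT1_eq e1) => /= eb; subst b'.
have {}e1 := existT_inj e1; move: (projT1_eq e1) => /= ea; subst a'.
have {}e1 := existT_inj e1; move: (projT1_eq e1) => /= eT; subst T'.
have {}e1 := existT_inj e1; subst p'.
have {}Eq i : mkcell (q i) = mkcell (q' i) by exact: (IH i _ _ _ (Eq i) (Eq' i)).
have : (fun i => mkrelt (q i)) = (fun i => mkrelt (q' i)).
  by apply: functional_extensionality_dep => i; apply: relt_cell_inj; exact: (congr1 (@pcell _) (Eq i)).
by move=> eR; exact: existT_inj (congr1 (fun R => relt_cell (@pcomp _ (mkcell p) R)) eR).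
Qed.

Lemma pevaluates_inj F r r' : pevaluates F r -> pevaluates F r' ->
  cell_out (projT2 r) = cell_out (projT2 r') -> r = r'.
Proof. by case=> c E -> [c' E' ->] e; rewrite (evaluates_inj E E' e). Qed.

Lemma pevaluates_leaf (f : forall v : vertex leaf, cell (arity v)) a :
  pevaluates (mktfam f) (pcell (mkcell (rid C a))).
Proof. by exists (mkcell (rid C a)) => //; exists a. Qed.

Lemma pevaluates_node k (c : cell k) (F : 'I_k -> tfam cell) (R : forall i, relt C (cell_in c i)) :
  (forall i, pevaluates (F i) (relt_cell (R i))) -> pevaluates (pnode c F) (relt_cell (pcomp R)).
Proof.
case: c R => b [a [T p]] R ER.
have H i : exists q : {T : TR (nleaves (projT1 (F i))) & {x & rC C T x (b i)}},
   evaluates (projT2 (F i)) (mkcell (projT2 (projT2 q))) /\ R i = mkrelt (projT2 (projT2 q)).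
  case: (ER i) => -[x [a' [T' q]]] E e.
  have ea : a' = b i by have := congr1 (fun r => cell_out (projT2 r)) e.
  subst a'; exists (existT _ T' (existT _ x q)); split => //.
  exact: relt_cell_inj.
pose q i := projT1 (cid (H i)); have Eq i := projT2 (cid (H i)).
have -> : R = fun i => mkrelt (projT2 (projT2 (q i))).
  by apply: functional_extensionality_dep => i; case: (Eq i).
exists (mkcell (rcomp (fun i => projT2 (projT2 (q i))) p)) => //.
exists T, b, a, p, (fun i => projT1 (q i)), (fun i => projT1 (projT2 (q i))),
  (fun i => projT2 (projT2 (q i))).
by split=> // i; case: (Eq i).
Qed.

(** Puts the arguments of a composite into the two-index form that associativity demands. *)
Lemma concat_split (B : C0 -> Type) n (k : 'I_n -> nat) (x : forall i, 'I_(k i) -> C0)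
    (R : forall s, B (concat x s)) :
  exists h : forall i j, B (x i j), R = fun s => h (tagnat.sig1 s) (tagnat.sig2 s).
Proof.
exists (fun i j => eq_rect _ B (R (tagnat.Rank i j)) _ (concat_Rank x j)).
apply: functional_extensionality_dep => s; apply: (@existT_inj _ B).
have castE a b (e : a = b) (y : B a) : existT B b (eq_rect a B y b e) = existT B a y by case: b / e.
by rewrite castE tagnat.sig2K.
Qed.

Lemma concat_unsplit (B : C0 -> Type) n (k : 'I_n -> nat) (x : forall i, 'I_(k i) -> C0)
    (h : forall i j, B (x i j)) i (j : 'I_(k i)) (s := tagnat.Rank i j) :
  existT B (concat x s) (h (tagnat.sig1 s) (tagnat.sig2 s)) = existT B (x i j) (h i j).
Proof.
pose F (z : {i & 'I_(k i)}) := existT B (x (tag z) (tagged z)) (h (tag z) (tagged z)).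
by rewrite -[RHS]/(F (existT _ i j)) -[LHS]/(F (tagnat.sig s)) /s /tagnat.Rank tagnat.rankK.
Qed.

Lemma evaluates_tree t (f : forall v : vertex t, cell (arity v)) c :
  evaluates f c -> tr_tree (cell_tree c) = tsubst (fun v => cell_tree (f v)).
Proof.
elim: t f c => [|k ts IH] f c; first by case=> a ->.
case=> T [b [a [p [Ts [x [q [e Eq ->]]]]]]] /=; rewrite /cell_tree /=.
have {Eq} eT i := IH _ _ _ (Eq i).
move: (f None) e => _ -> /=; congr graft; apply/funext => l; exact: eT.
Qed.

Lemma evaluates_exists t (b : edge t -> C0) (s : forall v : vertex t, TR (arity v))
    (y : forall v, rC C (s v) (ins b v) (out b v)) :
  exists (T : TR (nleaves t)) (w : rC C T (fun j => b (leaf_edge (leaf_at j))) (b (root_edge t))),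
    evaluates (fun v => mkcell (y v)) (mkcell w).
Proof.
elim: t b s y => [|k ts IH] b s y; first by exists triv, (rid C (b tt)), (b tt).
pose c i := cid (IH i (fun e => b (esub e)) (fun v => s (vsub v)) (fun v => y (vsub v))).
pose d i := cid (projT2 (c i)).
exists (Graft (s None) (fun i => projT1 (c i))), (rcomp (fun i => projT1 (d i)) (y None)).
do 4 eexists; exists (fun i => projT1 (c i)); eexists; exists (fun i => projT1 (d i)).
split=> // i; exact: projT2 (d i).
Qed.

Lemma mktfam_cast P t t' (f : forall v : vertex t, P (arity v)) :
  t = t' -> exists f' : forall v : vertex t', P (arity v), mktfam f' = mktfam f.
Proof. by move=> e; case: t' / e; exists f. Qed.

(** The source of a map is the tree obtained by substituting its family, so equal families on equal
    targets already give equal maps. *)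
Lemma ract_pack n (t1 t1' t2 t2' : TR n) (p1 : trmap t1' t1) (p2 : trmap t2' t2)
    x a (f1 : rC C t1 x a) (f2 : rC C t2 x a) :
  mktfam p1 = mktfam p2 -> mkcell f1 = mkcell f2 -> mkcell (ract p1 f1) = mkcell (ract p2 f2).
Proof.
move=> ep ef; have {}ef := existT_inj (existT_inj ef).
have /= e := projT1_eq ef.
case: t2 / e f2 p2 ep ef => f2 p2 ep ef; move: (existT_inj ef) => {ef} <-.
have {}ep := existT_inj ep.
case: p1 p2 ep => p1 e1 [p2 e2] /= ep; subst p2.
by case: t1' / e1; case: t2' / e2.
Qed.

(** * Evaluation under the laws: grafting, substitution and the action of maps *)

Hypothesis CL : relaxed_laws C.

Lemma pcompA n (c : cell n) (k : 'I_n -> nat) (ts : forall i, TR (k i)) (x : forall i, 'I_(k i) -> C0)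
    (g : forall i, rC C (ts i) (x i) (cell_in c i)) (h : forall i j, relt C (x i j)) :
  pcomp (c := c) (fun i => pcomp (c := mkcell (g i)) (h i)) =
  pcomp (c := mkcell (rcomp g (cell_val c))) (fun s => h (tagnat.sig1 s) (tagnat.sig2 s)).
Proof. exact: rcompA. Qed.

Lemma pcomp1r n (c : cell n) :
  pcomp (fun i => mkrelt (rid C (cell_in c i))) = mkrelt (cell_val c).
Proof. exact: rcomp1r. Qed.

Lemma pcomp1l a (r : relt C a) : pcomp (c := mkcell (rid C a)) (fun _ => r) = r.
Proof. by case: r => n [t [x f]]; apply: rcomp1l. Qed.

(** Induction on [t]. At a vertex, associativity turns composition with the value of the whole tree
    into composition at the root of composites on the subtrees; on the trivial tree the left
    identity law applies. *)
Lemma evaluates_graft t (us : leafpos t -> tree) (f : forall v : vertex t, cell (arity v))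
    (g : forall l (w : vertex (us l)), cell (arity w)) c (R : forall j, relt C (cell_in c j)) :
  evaluates f c -> (forall l, pevaluates (mktfam (g l)) (relt_cell (R (leaf_index l)))) ->
  pevaluates (mktfam (graft_fam f g)) (relt_cell (pcomp R)).
Proof.
elim: t us f g c R => [|k ts IH] us f g c R.
  case=> a e; subst c => ER.
  have -> : R = (fun _ => R ord0) by apply: functional_extensionality_dep => j; rewrite (ord1 j).
  rewrite pcomp1l; exact: (ER tt).
case=> T [b [a [p [Ts [x [q [e Eq ec]]]]]]]; subst c => ER.
(* A leaf of a node is a leaf of one of its subtrees; [R] is split accordingly. *)
have [h eh] := @concat_split (relt C) _ _ x R; subst R.
rewrite -(pcompA (c := mkcell p)).
have := @pevaluates_node k (mkcell p)
  (fun i => mktfam (graft_fam (us := fun l => us (lsub l))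
     (fun v => f (vsub (i := i) v)) (fun l => g (lsub l))))
  (fun i => pcomp (c := mkcell (q i)) (h i)).
rewrite [mktfam (graft_fam f g)]mktfam_node /= e; apply=> i.
apply: IH (Eq i) _ => l.
have := ER (lsub l).
pose phi (z : {a & relt C a}) := relt_cell (projT2 z).
by move: (congr1 phi (concat_unsplit h (leaf_index l))); rewrite /phi /= => ->.
Qed.

Lemma pevaluates_graft n (T : TR n) (us : leafpos T -> tree) (f : forall v : vertex T, cell (arity v))
    (g : forall l (w : vertex (us l)), cell (arity w)) (c : cell n) (R : forall j, relt C (cell_in c j)) :
  pevaluates (mktfam f) (pcell c) -> (forall l, pevaluates (mktfam (g l)) (relt_cell (R (lidx l)))) ->
  pevaluates (mktfam (graft_fam f g)) (relt_cell (pcomp R)).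
Proof.
case: T us f g => T eT us f g; have eT' := eqP eT; subst n; rewrite /= in f g *.
case=> c' E ec; have {}ec := existT_inj ec; subst c' => ER.
apply: evaluates_graft E _ => l; move: (ER l).
by rewrite (_ : lidx _ = leaf_index l) //; apply: val_inj.
Qed.

(** Substitution into [t] grafts the substituted subtrees onto the tree replacing the root vertex,
    so evaluation of grafts applies inductively. *)
Lemma evaluates_subst t (s : forall v : vertex t, TR (arity v))
    (f : forall v (w : vertex (s v)), cell (arity w)) (c : forall v : vertex t, cell (arity v)) r :
  (forall v, pevaluates (mktfam (f v)) (pcell (c v))) -> pevaluates (mktfam c) r ->
  pevaluates (mktfam (subst_fam f)) r.
Proof.
move=> Ef [d Ed ->] {r}; rewrite /= in Ed.
elim: t s f c d Ef Ed => [|k ts IH] s f c d Ef; first by case=> a ->; apply: pevaluates_leaf.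
case=> T [b [a [p [Ts [x [q [e Eq ->]]]]]]] /=.
apply: (@pevaluates_graft _ (s None) _ _ _ (mkcell p) (fun i => mkrelt (q i))).
  by rewrite -e.
move=> l; apply: (IH _ _ _ (fun v => c (vsub v))) (Eq _) => v; exact: (Ef (vsub v)).
Qed.

(** A corolla evaluates to its cell composed with identities, which the right identity law
    removes. *)
Lemma pevaluates_corolla k (c : cell k) :
  pevaluates (mktfam (corolla_rect (P := fun v => cell (arity v)) c)) (pcell c).
Proof.
have -> : pcell c = relt_cell (pcomp (fun i => mkrelt (rid C (cell_in c i)))).
  by rewrite pcomp1r; case: c => x [a [T p]].
rewrite mktfam_node; apply: pevaluates_node => i; exact: pevaluates_leaf.
Qed.

Lemma pevaluates_twolevel n (c : cell n) (k : 'I_n -> nat) (d : forall i, cell (k i))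
    (R : forall i, relt C (cell_in c i)) :
  (forall i, pcell (d i) = relt_cell (R i)) ->
  pevaluates (mktfam (twolevel_rect (P := fun v => cell (arity v)) c d)) (relt_cell (pcomp R)).
Proof.
move=> ed; rewrite mktfam_node; apply: pevaluates_node => i.
rewrite -ed; exact: pevaluates_corolla.
Qed.

(** The action along the map given by a bare family [s]: its source is taken to be the substituted
    tree itself. *)
Definition cact k (c : cell k) (s : forall v : vertex (cell_tree c), TR (arity v)) : cell k :=
  mkcell (ract (MkTrmap (erefl (Tsubst s))) (cell_val c)).

(** Naturality, by induction: compatibility of composition with the action at a vertex, and
    [f.1 = f] on the trivial tree. *)
Lemma evaluates_act t (f : forall v : vertex t, cell (arity v)) c
    (s : forall v (w : vertex (cell_tree (f v))), TR (arity w))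
    (s' : forall w : vertex (cell_tree c), TR (arity w)) :
  evaluates f c -> mktfam s' = mktfam (subst_fam s) -> evaluates (fun v => cact (s v)) (cact s').
Proof.
elim: t f c s s' => [|k ts IH] f c s s'.
  case=> a e; subst c => _; exists a.
  rewrite /cact -[in RHS](ract1 CL (rid C a)); apply: ract_pack => //.
  by congr existT; apply: eq_fam; case.
case=> T [b [a [p [Ts [x [q [e Eq ec]]]]]]]; subst c => es.
(* The part of [s'] over the i-th subtree must live on [Ts i], which equals the substituted subtree
   only provably. *)
have H i : exists si : forall w : vertex (Ts i), TR (arity w),
    mktfam si = mktfam (subst_fam (fun v => s (vsub (i := i) v))).
  by apply: mktfam_cast; rewrite (evaluates_tree (Eq i)).
pose si i := projT1 (cid (H i)).
have esi i : mktfam (si i) = mktfam (subst_fam (fun v => s (vsub (i := i) v))) :=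
  projT2 (cid (H i)).
have Eact i := IH i _ (mkcell (q i)) (fun v => s (vsub v)) (si i) (Eq i) (esi i).
move: es e Eact; rewrite [in mktfam s' = _]/= [evaluates _ (cact s')]/=.
move: (f None) (s None) => c0 s0 es e; subst c0 => Eact.
exists _, _, _, (ract (MkTrmap (erefl (Tsubst s0))) p), _, _,
  (fun i => ract (MkTrmap (erefl (Tsubst (si i)))) (q i)).
split=> //.
rewrite -(rcomp_act CL); apply: ract_pack => //.
apply: etrans es _; apply: mktfam_graft1 => l; exact: esym (esi _).
Qed.

Lemma pevaluates_act t (f : forall v : vertex t, cell (arity v)) k (c : cell k)
    (s : forall v (w : vertex (cell_tree (f v))), TR (arity w))
    (s' : forall w : vertex (cell_tree c), TR (arity w)) :
  pevaluates (mktfam f) (pcell c) -> mktfam s' = mktfam (subst_fam s) ->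
  pevaluates (mktfam (fun v => cact (s v))) (pcell (cact s')).
Proof.
case=> d E e; move: (projT1_eq e) => /= ek; subst k.
have {}e := existT_inj e; subst d => es.
by exists (cact s') => //; apply: evaluates_act.
Qed.

Lemma cact_trmap k (t t' : TR k) (p : trmap t' t) x a (f : rC C t x a) :
  cact (c := mkcell f) p = mkcell (ract p f).
Proof. by case: p => s e; case: t' / e. Qed.
End Cells.

(** * Edge labels and the enriched composition law *)

Section Boundary.
Variable A : Type.

Definition bdry t (b : edge t -> A) (v : vertex t) : ('I_(arity v) -> A) * A :=
  (ins b v, out b v).

(** [graft_lab] labels a junction edge from the tree grafted above it, so the input labels of a
    vertex of [t] survive because the labels match there. *)
Lemma graft_bdry t (us : leafpos t -> tree) (b : edge t -> A) (m : forall l, edge (us l) -> A) :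
  (forall l, m l (root_edge (us l)) = b (leaf_edge l)) ->
  forall u, bdry (graft_lab b m) u =
    graft_fam (P := fun k => (('I_k -> A) * A)%type) (bdry b) (fun l => bdry (m l)) u.
Proof.
elim: t us b m => [|k ts IH] us b m hm u //=.
case: u => [[i u]|] /=.
  exact: (IH i (fun l => us (lsub l)) (fun e => b (esub e)) (fun l => m (lsub l)) (fun l => hm (lsub l))).
congr pair; apply: functional_extensionality_dep => j /=.
exact: (graft_lab_root (us := fun l => us (lsub l)) (b := fun e => b (esub e)) (fun l => hm (lsub l))).
Qed.

Lemma subst_bdry t (s : forall v : vertex t, TR (arity v)) (b : edge t -> A)
    (m : forall v, edge (s v) -> A) :
  (forall v l, m v (leaf_edge l) = ins b v (lidx l)) ->
  (forall v, m v (root_edge (s v)) = out b v) ->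
  forall u, bdry (subst_lab b m) u =
    subst_fam (P := fun k => (('I_k -> A) * A)%type) (fun v => bdry (m v)) u.
Proof.
elim: t s b m => [|k ts IH] s b m hl hr u /=; first by case: u.
rewrite graft_bdry; last first.
  move=> l; rewrite (subst_lab_root (m := fun v => m (vsub v))).
  - by rewrite (hl None).
  - by move=> v l'; exact: (hl (vsub v)).
  - by move=> v; exact: (hr (vsub v)).
congr (graft_fam _ _ u); apply: functional_extensionality_dep => l; apply: eq_fam => w.
apply: (IH (lidx l) _ _ (fun v => m (vsub v))) => v; first by move=> l'; exact: (hl (vsub v)).
exact: (hr (vsub v)).
Qed.

(** Every edge is the root edge or an input of some vertex. *)
Lemma bdry_inj t (b b' : edge t -> A) :
  (forall v, bdry b v = bdry b' v) -> b (root_edge t) = b' (root_edge t) -> b = b'.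
Proof.
elim: t b b' => [|k ts IH] b b' e e0; first by apply/funext => -[].
apply/funext => -[[i x]|] //.
apply: (congr1 (fun h => h x)) (IH i (fun x => b (esub x)) (fun x => b' (esub x)) _ _).
  by move=> v; exact: (e (vsub v)).
by have /(congr1 (fun h => h.1 i)) := e None.
Qed.
End Boundary.

(** * Cells of a family of presheaves, and the conditions on [kappa] in terms of values *)

Section PshCells.
Variables (C0 : Type) (F : forall n, ('I_n -> C0) -> C0 -> psh n).

(* For F the hom objects of an enriched multicategory E, this is convertible to
   [cell (underlying E)]. *)
Definition ecell k : Type := {x : 'I_k -> C0 & {a : C0 & pelt (F x a)}}.
Definition mkecell k (x : 'I_k -> C0) (a : C0) (z : pelt (F x a)) : ecell k :=
  existT _ x (existT _ a z).
Definition ecell_bdry k (c : ecell k) : ('I_k -> C0) * C0 := (projT1 c, projT1 (projT2 c)).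
(** Forgets the boundary labels: [F] may take the same value at different labels. *)
Definition ecell_labelt k (c : ecell k) : labelt k := mklabelt (projT2 (projT2 c)).

Lemma mkecell_inj k (x : 'I_k -> C0) (a : C0) (z z' : pelt (F x a)) :
  mkecell z = mkecell z' -> z = z'.
Proof. by move=> e; exact: existT_inj (existT_inj e). Qed.

Lemma ecell_ext k (c c' : ecell k) :
  ecell_bdry c = ecell_bdry c' -> ecell_labelt c = ecell_labelt c' -> c = c'.
Proof.
case: c c' => x [a z] [x' [a' z']] [/= ex ea]; subst x' a' => e.
by rewrite (existT_inj e : z = z').
Qed.

Definition lab_ltree n (x : 'I_n -> C0) (a : C0) (D : labtree x a) : ltree psh n :=
  MkLtree (lt_tree := D) (fun v => F (ins (lb_lab D) v) (out (lb_lab D) v)).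

Definition lab_cells n (x : 'I_n -> C0) (a : C0) (D : labtree x a)
    (z : forall v, pelt (lt_lab (lab_ltree D) v)) (v : vertex D) : ecell (arity v) :=
  mkecell (z v).

Lemma lab_cells_surj n (x : 'I_n -> C0) (a : C0) (D : labtree x a)
    (f : forall v : vertex D, ecell (arity v)) :
  (forall v, ecell_bdry (f v) = bdry (lb_lab D) v) ->
  exists z : forall v, pelt (lt_lab (lab_ltree D) v), lab_cells z = f.
Proof.
move=> e.
have H v : exists z : pelt (lt_lab (lab_ltree D) v), mkecell z = f v.
  move: (e v); rewrite /bdry /lab_ltree /=; case: (f v) => y [b z] [/= <- <-]; by exists z.
by exists (fun v => projT1 (cid (H v))); apply: eq_fam => v; exact: projT2 (cid (H v)).
Qed.

Lemma lab_bdry_subst n (x : 'I_n -> C0) (a : C0) (D : labtree x a)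
    (Ds : forall v : vertex D, labtree (ins (lb_lab D) v) (out (lb_lab D) v)) u :
  bdry (lb_lab (labsubst Ds)) u =
  subst_fam (P := fun k => (('I_k -> C0) * C0)%type) (fun v => bdry (lb_lab (Ds v))) u.
Proof. by apply: subst_bdry => v; [exact: lb_leaves | exact: lb_root]. Qed.

Lemma into_Vap n (G : psh n) (X Y : into Vhom G) : X = Y ->
  forall z z', mktfam (fun v => mklabelt (z v)) = mktfam (fun v => mklabelt (z' v)) ->
  Vap (projT2 X) z = Vap (projT2 Y) z'.
Proof. by move=> <- z z' /mklabelt_inj ->. Qed.

Section Subst.
Variables (n : nat) (x : 'I_n -> C0) (a : C0) (D : labtree x a).
Variable Ds : forall v : vertex D, labtree (ins (lb_lab D) v) (out (lb_lab D) v).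
Variables (K : Vhom (lab_ltree D) (F x a)) (KS : Vhom (lab_ltree (labsubst Ds)) (F x a)).
Variable KDs : forall v, Vhom (lab_ltree (Ds v)) (F (ins (lb_lab D) v) (out (lb_lab D) v)).

Lemma cells_subst_bdry (z : forall v w, pelt (lt_lab (lab_ltree (Ds v)) w)) u :
  ecell_bdry (subst_fam (fun v => lab_cells (z v)) u) = bdry (lb_lab (labsubst Ds)) u.
Proof. by rewrite lab_bdry_subst -(subst_fam_map ecell_bdry). Qed.

(** Reduces closure under composition to values. The hom objects labelling the two domains agree
    only provably, so arguments are compared as families of cells, whose type depends on arities
    alone. *)
Lemma kappa_substP :
  existT (fun T => Vhom T (F x a)) _ KS =
  existT (fun T => Vhom T (F x a)) _
    (Vcomp K (fun v => existT (fun S => Vhom S (lt_lab (lab_ltree D) v)) _ (KDs v))) <->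
  forall (z : forall v w, pelt (lt_lab (lab_ltree (Ds v)) w))
      (Z : forall u, pelt (lt_lab (lab_ltree (labsubst Ds)) u)),
    lab_cells (D := labsubst Ds) Z = subst_fam (fun v => lab_cells (z v)) ->
    Vap KS Z = Vap K (fun v => Vap (KDs v) (z v)).
Proof.
split=> [/into_Vap eK z Z eZ|eK].
  (* The elements [z], placed on the domain of the composite, whose vertex objects are given by
     [subst_fam] instead of by edge labels. *)
  pose z' := subst_famd (R := pelt) z.
  have ez' v w : subst_res (R := pelt) z' w = z v w.
    apply: (@existT_inj _ (@pelt _)).
    have := @subst_fam_inj labelt _ _ (fun v w => mklabelt (subst_res (R := pelt) z' (v := v) w))
              (fun v w => mklabelt (z v w)) _ v w.
    apply=> u; exact: etrans (subst_res_eq (R := pelt) z' u) (esym (subst_famd_eq (R := pelt) z u)).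
  have {}eK := eK Z z'; rewrite Vap_comp in eK; rewrite eK; last first.
    congr mktfam; apply: eq_fam => u.
    rewrite -[LHS]/(ecell_labelt (lab_cells (D := labsubst Ds) Z u)) eZ -(subst_fam_map ecell_labelt).
    exact: (subst_famd_eq (R := pelt)).
  congr Vap; apply: eq_fam => v; congr Vap; apply: eq_fam => w; exact: ez'.
apply: Vinto_ext => [|Z z' ez].
  congr mktfam; apply: eq_fam => u.
  (* The hom object at a vertex is a function of its boundary, so the domains agree because the
     boundaries do. *)
  pose phi k (p : ('I_k -> C0) * C0) : psh k := F p.1 p.2.
  rewrite -[LHS]/(phi _ (bdry (lb_lab (labsubst Ds)) u)) lab_bdry_subst.
  by rewrite -(subst_fam_map phi).
apply: etrans _ (esym (Vap_comp K z')); apply: eK; apply: eq_fam => u; apply: ecell_ext.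
  by rewrite cells_subst_bdry.
rewrite -(subst_fam_map ecell_labelt) -[LHS]/(mklabelt (Z u)).
have := congr1 (fun f => f u) (mktfam_inj ez); rewrite /= => ->.
exact: (congr1 (fun f => f u) (lsubst_pack z')).
Qed.
End Subst.

Lemma kappa_corollaP n (x : 'I_n -> C0) (a : C0) (K : Vhom (lab_ltree (labcorolla x a)) (F x a)) :
  existT (fun T => Vhom T (F x a)) _ K = existT (fun T => Vhom T (F x a)) _ (Vid (F x a)) <->
  forall z, Vap K z = z None.
Proof.
split=> [/into_Vap eK z|eK].
  pose z' : forall v, pelt (lt_lab (lcorolla (F x a)) v) :=
    @corolla_rect n (fun v => pelt (lt_lab (lcorolla (F x a)) v)) (z None).
  suff e : Vap K z = Vap (Vid (F x a)) z' by rewrite e Vap_id.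
  by apply: (eK z z'); congr mktfam; apply: eq_fam => -[[i []]|].
apply: Vinto_ext => [|z z' ez] /=; first by congr mktfam; apply: eq_fam => -[[i []]|].
rewrite eK Vap_id; apply: (@existT_inj _ (@pelt n)).
exact: (congr1 (fun f => f None) (mktfam_inj ez)).
Qed.
End PshCells.

(** The labels around the vertices and the root label recover all edge labels; [n] is the number of
    leaves and [x] lists their labels. *)
Lemma labtree_bdry_inj (A : Type) n n' (x : 'I_n -> A) (x' : 'I_n' -> A) (a : A)
    (D : labtree x a) (D' : labtree x' a) :
  mktfam (P := fun k => (('I_k -> A) * A)%type) (bdry (lb_lab D)) = mktfam (bdry (lb_lab D')) ->
  existT (fun n => {x : 'I_n -> A & labtree x a}) n (existT _ x D) = existT _ n' (existT _ x' D').
Proof.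
case: D D' => [[t et] b bl br] [[t' et'] b' bl' br'] /= e.
have et0 := mktfam_tree e; subst t'.
have en : n = n' by rewrite -(eqP et) -(eqP et').
subst n'; move: bl bl'; rewrite (bool_irrelevance et' et) => bl bl'.
have eb : b = b'.
  apply: bdry_inj; last by rewrite br br'.
  by move=> v; rewrite (mktfam_inj e).
subst b'.
have ex : x = x' by apply/funext => i; rewrite -(lidxK (MkTR et) i) -bl bl'.
subst x'; by rewrite (Prop_irrelevance bl' bl) (Prop_irrelevance br' br).
Qed.

(** * The relaxed multicategory underlying an enriched one *)

Section Kappa.
Variables (C0 : Type) (E : enriched presheaf_T2 C0).
Let F n (x : 'I_n -> C0) (a : C0) : psh n := eC E x a.
Let enriched_kappa n (x : 'I_n -> C0) (a : C0) (D : labtree x a) : Vhom (lab_ltree F D) (F x a) := kappa E D.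
Notation ucell := (cell (underlying E)).

(** The graph of all the arrows [kappa], in the form of [pevaluates], with which it is to be
    compared. *)
Definition kevaluates (G : tfam ucell) (r : {k & ucell k}) : Prop :=
  exists n (x : 'I_n -> C0) (a : C0) (D : labtree x a) (z : forall v, pelt (lt_lab (lab_ltree F D) v)),
    G = mktfam (P := ucell) (lab_cells z) /\
    r = pcell (C := underlying E) (mkecell (Vap (enriched_kappa D) z)).

(** The boundaries of the cells in [G] and the output label determine [D]; the cells then determine
    the arguments. *)
Lemma kevaluates_inj G r r' : kevaluates G r -> kevaluates G r' ->
  cell_out (projT2 r) = cell_out (projT2 r') -> r = r'.
Proof.
case=> n [x [a [D [z [eG ->]]]]] [n' [x' [a' [D' [z' [eG' ->]]]]]] /= ea.
rewrite /cell_out /= in ea; subst a' G.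
pose phi (G : tfam ucell) : tfam (fun k => (('I_k -> C0) * C0)%type) :=
  mktfam (fun v => @ecell_bdry _ F _ (projT2 G v)).
have eD := labtree_bdry_inj (congr1 phi eG').
have /= en := projT1_eq eD; subst n'; have {}eD := existT_inj eD.
have /= ex := projT1_eq eD; subst x'; have {}eD := existT_inj eD; subst D'.
suff -> : z = z' by [].
have ez := mktfam_inj eG'; apply: eq_fam => v; apply: mkecell_inj.
exact: (congr1 (fun f : forall v, ucell (arity v) => f v) ez).
Qed.

(** The data behind a value of [kappa] with output label [a], bundled so that one can be chosen for
    each input. *)
Record lab_elt (a : C0) : Type := LabElt {
  le_n : nat;
  le_x : 'I_le_n -> C0;
  le_tree : labtree le_x a;
  le_elt : forall v, pelt (lt_lab (lab_ltree F le_tree) v)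
}.

Definition le_val (a : C0) (w : lab_elt a) : relt (underlying E) a :=
  mkrelt (C := underlying E) (projT2 (Vap (enriched_kappa (le_tree w)) (@le_elt _ w))).

Lemma kevaluates_relt G a (r : relt (underlying E) a) : kevaluates G (relt_cell r) ->
  exists w : lab_elt a, G = mktfam (P := ucell) (lab_cells (@le_elt _ w)) /\ r = le_val w.
Proof.
case=> n [x [a' [D [z [eG er]]]]].
have ea : a = a' := congr1 (fun r => cell_out (projT2 r)) er; subst a'.
by exists (LabElt z); split=> //; apply: relt_cell_inj.
Qed.

Lemma enriched_kappa_subst n (x : 'I_n -> C0) (a : C0) (D : labtree x a)
    (Ds : forall v : vertex D, labtree (ins (lb_lab D) v) (out (lb_lab D) v))
    (z : forall v w, pelt (lt_lab (lab_ltree F (Ds v)) w))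
    (Z : forall u, pelt (lt_lab (lab_ltree F (labsubst Ds)) u)) :
  lab_cells (D := labsubst Ds) Z = subst_fam (fun v => lab_cells (z v)) ->
  Vap (enriched_kappa (labsubst Ds)) Z = Vap (enriched_kappa D) (fun v => Vap (enriched_kappa (Ds v)) (z v)).
Proof.
have e := kappa_subst E Ds; cbn [presheaf_T2 compm hom ob] in e.
exact: (proj1 (kappa_substP (enriched_kappa D) (enriched_kappa (labsubst Ds))
  (fun v => enriched_kappa (Ds v))) e z Z).
Qed.

Lemma kevaluates_corolla k (c : ucell k) :
  kevaluates (mktfam (corolla_rect (P := fun v => ucell (arity v)) c)) (pcell c).
Proof.
case: c => x [a z].
pose z0 : forall v, pelt (lt_lab (lab_ltree F (labcorolla x a)) v) :=
  @corolla_rect k (fun v => pelt (lt_lab (lab_ltree F (labcorolla x a)) v)) z.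
exists k, x, a, (labcorolla x a), z0; split.
  by congr mktfam; apply: eq_fam => -[[i []]|].
have /kappa_corollaP -> // := kappa_corolla E x a.
Qed.

Lemma kevaluates_triv (f : forall v : vertex leaf, ucell (arity v)) a :
  kevaluates (mktfam f) (pcell (mkcell (rid (underlying E) a))).
Proof.
pose z : forall v, pelt (lt_lab (lab_ltree F (labtriv a)) v) := fun v : void => match v with end.
exists 1, (fun _ => a), a, (labtriv a), z; split; first by congr mktfam; apply: eq_fam; case.
have e : existT (pob (F (fun _ => a) a)) triv (underlying_id E a) = Vap (enriched_kappa (labtriv a)) z.
  rewrite /underlying_id pcastE /Vap /enriched_kappa.
  set z0 : forall v : vertex triv, TR (arity v) := fun v => match v with end.
  have ez : (fun v => existT (pob (lt_lab (lab_ltree F (labtriv a)) v)) (z0 v) (match v with end)) = z.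
    by apply: eq_fam; case.
  by rewrite -ez.
exact: (congr1 (fun w => pcell (C := underlying E) (mkecell w)) e).
Qed.

Lemma underlying_compE n (t : TR n) (k : 'I_n -> nat) (ts : forall i, TR (k i))
    (x : forall i, 'I_(k i) -> C0) (b : 'I_n -> C0) (a : C0)
    (g : forall i, F (x i) (b i) (ts i)) (f : F b a t) (L := labtwolevel x b a)
    (z : forall v, pelt (lt_lab (lab_ltree F L) v)) :
  z None = existT (F b a) t f ->
  (forall i, z (vsub (ts := fun i => corolla (k i)) (i := i) None) = existT (F (x i) (b i)) (ts i) (g i)) ->
  existT (F (concat x) a) (Graft t ts) (underlying_comp g f) = Vap (enriched_kappa L) z.
Proof.
move=> e0 e1; rewrite /underlying_comp pcastE /Vap.
set t' : forall v : vertex L, TR (arity v) := twolevel_rect _ _.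
set y' : forall v, lt_lab (lab_ltree F L) v (t' v) := twolevel_rect _ _.
suff <- : (fun v => existT (lt_lab (lab_ltree F L) v) (t' v) (y' v)) = z by [].
apply: eq_fam => -[[i [[j []]|]]|]; [exact: esym (e1 i) | exact: esym e0].
Qed.

(** The central use of closure under substitution: put [D] at the root of the two-level tree and
    [Ds i] above its i-th input. The arrow of the two-level tree is the underlying composition, so
    composites of values of [kappa] are values of [kappa]. *)
Lemma kevaluates_compose n (x : 'I_n -> C0) (a : C0) (D : labtree x a)
    (z : forall v, pelt (lt_lab (lab_ltree F D) v)) (k : 'I_n -> nat) (y : forall i, 'I_(k i) -> C0)
    (Ds : forall i, labtree (y i) (x i)) (zs : forall i v, pelt (lt_lab (lab_ltree F (Ds i)) v)) :
  kevaluates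
    (mktfam (P := ucell) (graft_fam (us := fun l : leafpos D => Ds (lidx l))
       (lab_cells z) (fun l => lab_cells (zs (lidx l)))))
    (pcell (mkcell (C := underlying E) (rcomp (r := underlying E)
       (fun i => projT2 (Vap (enriched_kappa (Ds i)) (zs i)))
       (projT2 (Vap (enriched_kappa D) z))))).
Proof.
pose L := labtwolevel y x a.
pose S : forall v : vertex L, labtree (ins (lb_lab L) v) (out (lb_lab L) v) :=
  @twolevel_rect n k (fun v => labtree (ins (lb_lab L) v) (out (lb_lab L) v)) D Ds.
pose zS : forall v w, pelt (lt_lab (lab_ltree F (S v)) w) :=
  @twolevel_rect n k (fun v => forall w, pelt (lt_lab (lab_ltree F (S v)) w)) z zs.
have [Z eZ] := lab_cells_surj (D := labsubst S) (cells_subst_bdry zS).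
exists _, _, _, (labsubst S), Z; split.
  (* Substituting [Ds i] for an upper vertex also grafts trivial trees onto its leaves, which
     changes nothing. *)
  rewrite eZ; apply: mktfam_graft1 => l; exact: esym (graft_fam1 _ _).
have eK := enriched_kappa_subst eZ.
have e : existT (pob (F (concat y) a)) _
    (underlying_comp (fun i => projT2 (Vap (enriched_kappa (Ds i)) (zs i)))
       (projT2 (Vap (enriched_kappa D) z))) =
  Vap (enriched_kappa (labsubst S)) Z.
  by rewrite eK; apply: underlying_compE.
exact: (congr1 (fun w => pcell (C := underlying E) (mkecell w)) e).
Qed.

Lemma kevaluates_graft n (T : TR n) (us : leafpos T -> tree) (f : forall v : vertex T, ucell (arity v))
    (g : forall l (w : vertex (us l)), ucell (arity w)) (c : ucell n)
    (R : forall j, relt (underlying E) (cell_in c j)) :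
  kevaluates (mktfam f) (pcell c) -> (forall l, kevaluates (mktfam (g l)) (relt_cell (R (lidx l)))) ->
  kevaluates (mktfam (graft_fam f g)) (relt_cell (pcomp R)).
Proof.
case=> n' [x [a [D [z [eF ec]]]]] H.
have /= en := projT1_eq ec; subst n'; have {}ec := existT_inj ec; subst c.
(* Reindexes by inputs instead of leaves, so that one labelled tree is chosen for each input. *)
have H' i : kevaluates (mktfam (g (lat T i))) (relt_cell (R i)).
  by have := H (lat T i); rewrite lidxK.
pose w i := projT1 (cid (kevaluates_relt (H' i))).
have Hw i : _ /\ R i = le_val (w i) := projT2 (cid (kevaluates_relt (H' i))).
have -> : R = fun i => le_val (w i).
  by apply: functional_extensionality_dep => i; case: (Hw i).
have eT : T = D by apply: TR_inj; apply: (mktfam_tree eF).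
subst T; have {}eF := mktfam_inj eF; subst f.
have -> : mktfam (graft_fam (lab_cells z) g) =
   mktfam (P := ucell) (graft_fam (us := fun l : leafpos D => le_tree (w (lidx l))) (lab_cells z)
      (fun l => lab_cells (@le_elt _ (w (lidx l))))).
  by apply: mktfam_graft1 => l; case: (Hw (lidx l)) => <- _; rewrite latK.
exact: (kevaluates_compose z (fun i => @le_elt _ (w i))).
Qed.

(** A tree with root cell [c] is a graft onto the corolla at [c]. *)
Lemma kevaluates_node k (c : ucell k) (G : 'I_k -> tfam ucell)
    (R : forall i, relt (underlying E) (cell_in c i)) :
  (forall i, kevaluates (G i) (relt_cell (R i))) -> kevaluates (pnode c G) (relt_cell (pcomp R)).
Proof.
move=> H.
pose us (l : leafpos (corolla k)) := projT1 (G (projT1 l)).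
have := @kevaluates_graft k (corolla k) us (corolla_rect (P := fun v => ucell (arity v)) c)
  (fun l => projT2 (G (projT1 l))) c R (kevaluates_corolla c).
apply=> -[i []]; rewrite (lidx_corolla i); move: (H i); rewrite /us /=.
by case: (G i).
Qed.

(** With uniqueness of values, this forces every [kappa] to be the evaluation map of the underlying
    operations. *)
Lemma kevaluates_evaluates t (f : forall v : vertex t, ucell (arity v)) c :
  evaluates f c -> kevaluates (mktfam f) (pcell c).
Proof.
elim: t f c => [|k ts IH] f c; first by case=> a ->; apply: kevaluates_triv.
case=> T [b [a [p [Ts [x [q [e Eq ->]]]]]]].
rewrite mktfam_node e.
apply: (@kevaluates_node k (mkcell p) (fun i => mktfam (fun v => f (vsub (i := i) v)))
  (fun i => mkrelt (q i))) => i.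
exact: IH (Eq i).
Qed.

Lemma kevaluates_relt_inj G a (r r' : relt (underlying E) a) :
  kevaluates G (relt_cell r) -> kevaluates G (relt_cell r') -> r = r'.
Proof. by move=> H H'; apply: relt_cell_inj; apply: kevaluates_inj H H' _. Qed.

(** This is naturality of the arrow of the two-level tree. *)
Lemma underlying_act n (t t' : TR n) (k : 'I_n -> nat) (ts ts' : forall i, TR (k i))
    (p : trmap t' t) (ps : forall i, trmap (ts' i) (ts i))
    (x : forall i, 'I_(k i) -> C0) (b : 'I_n -> C0) (a : C0)
    (f : F b a t) (g : forall i, F (x i) (b i) (ts i)) :
  pact (Graft_map p ps) (underlying_comp g f) =
  underlying_comp (fun i => pact (ps i) (g i)) (pact p f).
Proof.
pose L := labtwolevel x b a.
pose s : forall v : vertex L, TR (arity v) := @twolevel_rect n k (fun v => TR (arity v)) t ts.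
pose s' : forall v : vertex L, TR (arity v) := @twolevel_rect n k (fun v => TR (arity v)) t' ts'.
pose q : forall v : vertex L, trmap (s' v) (s v) := @twolevel_rect n k (fun v => trmap (s' v) (s v)) p ps.
pose y : forall v, lt_lab (lab_ltree F L) v (s v) :=
  @twolevel_rect n k (fun v => lt_lab (lab_ltree F L) v (s v)) f g.
pose y' : forall v, lt_lab (lab_ltree F L) v (s' v) :=
  @twolevel_rect n k (fun v => lt_lab (lab_ltree F L) v (s' v)) (pact p f) (fun i => pact (ps i) (g i)).
apply: (@existT_inj _ (pob (F (concat x) a))).
transitivity (existT (pob (F (concat x) a)) _ (vapp (enriched_kappa L) y'));
  last by rewrite /underlying_comp pcastE.
have -> : y' = fun v => pact (q v) (y v) by apply: eq_fam => -[[i [[j []]|]]|].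
rewrite -vapp_nat; apply: pact_pack; last by rewrite /underlying_comp pcastE.
apply: mktfam_graft1 => l; exact: esym (graft_fam1 _ _).
Qed.

Lemma underlying_assoc n (t : TR n) (k : 'I_n -> nat) (ts : forall i, TR (k i))
    (m : forall i, 'I_(k i) -> nat) (us : forall i j, TR (m i j))
    (a : C0) (b : 'I_n -> C0) (c : forall i, 'I_(k i) -> C0) (d : forall i j, 'I_(m i j) -> C0)
    (f : rC (underlying E) t b a) (g : forall i, rC (underlying E) (ts i) (c i) (b i))
    (h : forall i j, rC (underlying E) (us i j) (d i j) (c i j)) :
  mkrelt (rcomp (fun i => rcomp (h i) (g i)) f) =
  mkrelt (rcomp (b := concat c) (fun s => h (tagnat.sig1 s) (tagnat.sig2 s)) (rcomp g f)).
Proof.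
pose ch i j := corolla_rect (P := fun v => ucell (arity v)) (mkcell (h i j)).
(* The three-level tree with [f] at the root, the [g i] above it and the [h i j] above these; both
   composites are values on it. *)
apply: (@kevaluates_relt_inj (pnode (mkcell f) (fun i => pnode (mkcell (g i)) (fun j => mktfam (ch i j))))).
  apply: (@kevaluates_node n (mkcell f) _ (fun i => mkrelt (rcomp (h i) (g i)))) => i.
  apply: (@kevaluates_node _ (mkcell (g i)) _ (fun j => mkrelt (h i j))) => j.
  exact: kevaluates_corolla.
(* For the right side the same tree is presented as corollas grafted onto the two-level tree. *)
pose ch1 s := ch (tagnat.sig1 s) (tagnat.sig2 s).
pose f2 := twolevel_rect (P := fun v => ucell (arity v)) (mkcell f) (fun i => mkcell (g i)).
have H2 : kevaluates (mktfam f2) (pcell (mkcell (rcomp g f))).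
  rewrite mktfam_node.
  apply: (@kevaluates_node n (mkcell f) _ (fun i => mkrelt (g i))) => i; exact: kevaluates_corolla.
have := @kevaluates_graft _ (twolevel k) _ f2 (fun l => ch1 (lidx l)) (mkcell (rcomp g f))
  (fun s => mkrelt (h (tagnat.sig1 s) (tagnat.sig2 s))) H2 (fun l => kevaluates_corolla _).
congr kevaluates; rewrite mktfam_node; congr pnode; apply/funext => i.
rewrite mktfam_node; congr pnode; apply/funext => j.
pose phi (z : {i & 'I_(k i)}) := mktfam (ch (tag z) (tagged z)).
(* The leaf of the two-level tree at [(i, j)] has number [tagnat.Rank i j], from which [i] and [j]
   are recovered. *)
have e := congr1 tagnat.sig (lidx_twolevel (i := i) j).
rewrite /tagnat.Rank tagnat.rankK in e; exact: (congr1 phi e).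
Qed.

Lemma underlying_laws : relaxed_laws (underlying E).
Proof.
split.
- by move=> n t x a f; apply: pact1.
- by move=> n t t' t'' p p' x a f; apply: pactM.
- exact: underlying_assoc.
(* Identity laws: both sides are values on a corolla, first with trivial trees grafted onto it, then
   grafted onto the trivial tree. *)
- move=> n t b a f.
  apply: (@kevaluates_relt_inj (mktfam (corolla_rect (P := fun v => ucell (arity v)) (mkcell f))));
    last exact: kevaluates_corolla.
  rewrite mktfam_node; apply: (@kevaluates_node n (mkcell f) _ (fun i => mkrelt (rid _ (b i)))) => i.
  exact: kevaluates_triv.
- move=> n t x a f.
  apply: (@kevaluates_relt_inj (mktfam (corolla_rect (P := fun v => ucell (arity v)) (mkcell f))));
    last exact: kevaluates_corolla.
  have f0 : forall v : vertex triv, ucell (arity v) by case.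
  exact: (@kevaluates_graft 1 triv (fun _ => corolla n) f0 (fun _ => corolla_rect (mkcell f))
           (mkcell (rid _ a)) (fun _ => mkrelt f) (kevaluates_triv f0 a) (fun _ => kevaluates_corolla _)).
- exact: underlying_act.
Qed.
End Kappa.

(** * The enriched multicategory of a relaxed one *)

Lemma relaxed_data_ext C0 (C : relaxed_data C0) c i :
  c = @rcomp C0 C -> i = @rid C0 C -> MkRelaxedData (rC := rC C) (@ract C0 C) c i = C.
Proof. by case: C c i => rC0 ra c0 i0 c i /= -> ->. Qed.

Section Inverse.
Variables (C0 : Type) (C : relaxed_data C0).
Hypothesis CL : relaxed_laws C.

Definition relaxed_psh n (x : 'I_n -> C0) (a : C0) : psh n :=
  MkPsh (pob := fun t => rC C t x a) (pact := fun t t' p f => ract p f)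
    (fun t f => ract1 CL f) (fun t t' t'' p p' f => ractM CL p p' f).

Section Value.
Variables (n : nat) (x : 'I_n -> C0) (a : C0) (D : labtree x a).

Lemma relaxed_kappa_exists (t : forall v : vertex D, TR (arity v))
    (y : forall v, lt_lab (lab_ltree relaxed_psh D) v (t v)) :
  exists w : relaxed_psh x a (Tsubst t),
    pevaluates (mktfam (fun v => mkcell (C := C) (y v))) (pcell (mkcell (C := C) w)).
Proof.
move: t y; case: D => -[T eT] b bl br t y; have en := eqP eT; subst n a.
have [S [w Ew]] := evaluates_exists y.
have eS : S = Tsubst (t := MkTR eT) t by apply: TR_inj; exact: (evaluates_tree Ew).
have ex : x = fun j => b (leaf_edge (leaf_at j)).
  apply/funext => j; rewrite bl; congr x; apply: val_inj; by rewrite /= leaf_indexK.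
subst S x; exists w; by exists (mkcell w).
Qed.

(** The value is unique once its output label is fixed, so this choice is determined. *)
Definition relaxed_kappa_app t y := projT1 (cid (@relaxed_kappa_exists t y)).

Lemma relaxed_kappa_nat (t t' : forall v : vertex D, TR (arity v)) (p : forall v, trmap (t' v) (t v))
    (y : forall v, lt_lab (lab_ltree relaxed_psh D) v (t v)) :
  pact (Tsubst_map p) (relaxed_kappa_app y) = relaxed_kappa_app (fun v => pact (p v) (y v)).
Proof.
have H := projT2 (cid (relaxed_kappa_exists y)); rewrite -/(relaxed_kappa_app y) in H.
have H' := projT2 (cid (relaxed_kappa_exists (fun v => pact (p v) (y v)))).
rewrite -/(relaxed_kappa_app (fun v => pact (p v) (y v))) in H'.
have {}H := pevaluates_act CL (f := fun v => mkcell (C := C) (y v))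
  (c := mkcell (C := C) (relaxed_kappa_app y))
  (s := fun v => tm_fam (p v)) (s' := tm_fam (Tsubst_map p)) H erefl.
rewrite (cact_trmap (Tsubst_map p)) in H.
have ep : (fun v => cact (c := mkcell (C := C) (y v)) (p v)) = fun v => mkcell (C := C) (pact (p v) (y v)).
  by apply: eq_fam => v; exact: cact_trmap.
rewrite ep in H.
apply: (@mkcell_inj _ C); exact: existT_inj (pevaluates_inj H H' erefl).
Qed.

Definition relaxed_kappa : Vhom (lab_ltree relaxed_psh D) (relaxed_psh x a) :=
  @MkVhom n (lab_ltree relaxed_psh D) (relaxed_psh x a) relaxed_kappa_app relaxed_kappa_nat.

Lemma relaxed_kappaP (z : forall v, pelt (lt_lab (lab_ltree relaxed_psh D) v)) :
  pevaluates (C := C) (mktfam (P := cell C) (lab_cells z)) (pcell (C := C) (mkecell (Vap relaxed_kappa z))).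
Proof.
have := projT2 (cid (relaxed_kappa_exists (fun v => projT2 (z v)))).
congr pevaluates; congr mktfam; apply: eq_fam => v; rewrite /lab_cells; by case: (z v).
Qed.

Lemma relaxed_kappa_eq (z : forall v, pelt (lt_lab (lab_ltree relaxed_psh D) v))
    (w : pelt (relaxed_psh x a)) :
  pevaluates (C := C) (mktfam (P := cell C) (lab_cells z)) (pcell (C := C) (mkecell w)) ->
  Vap relaxed_kappa z = w.
Proof. by move=> H; apply: mkecell_inj; exact: existT_inj (pevaluates_inj (relaxed_kappaP z) H erefl). Qed.
End Value.

Lemma relaxed_kappa_subst n (x : 'I_n -> C0) (a : C0) (D : labtree x a)
    (Ds : forall v : vertex D, labtree (ins (lb_lab D) v) (out (lb_lab D) v)) :
  existT (fun T => Vhom T (relaxed_psh x a)) _ (relaxed_kappa (labsubst Ds)) =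
  existT (fun T => Vhom T (relaxed_psh x a)) _
    (Vcomp (relaxed_kappa D) (fun v =>
       existT (fun S => Vhom S (lt_lab (lab_ltree relaxed_psh D) v)) _ (relaxed_kappa (Ds v)))).
Proof.
apply/kappa_substP => z Z eZ; apply: relaxed_kappa_eq; rewrite eZ.
apply: (evaluates_subst CL) (relaxed_kappaP _) => v; exact: relaxed_kappaP.
Qed.

Lemma relaxed_kappa_corolla n (x : 'I_n -> C0) (a : C0) :
  existT (fun T => Vhom T (relaxed_psh x a)) _ (relaxed_kappa (labcorolla x a)) =
  existT (fun T => Vhom T (relaxed_psh x a)) _ (Vid (relaxed_psh x a)).
Proof.
apply/kappa_corollaP => z; apply: relaxed_kappa_eq.
have := pevaluates_corolla CL (mkecell (z None) : cell C n).
by congr pevaluates; congr mktfam; apply: eq_fam => -[[i []]|].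
Qed.

Definition enriched_of : enriched presheaf_T2 C0 :=
  @MkEnriched presheaf_T2 C0 relaxed_psh relaxed_kappa relaxed_kappa_subst relaxed_kappa_corolla.

(** Sets and actions agree by conversion; composition and identities are evaluations of the
    two-level tree and of the trivial tree. *)
Lemma underlying_enriched_of : underlying enriched_of = C.
Proof.
have ecomp : @underlying_comp C0 enriched_of = @rcomp C0 C.
  apply: functional_extensionality_dep => n; apply: functional_extensionality_dep => t.
  apply: functional_extensionality_dep => k; apply: functional_extensionality_dep => ts.
  apply: functional_extensionality_dep => x; apply: functional_extensionality_dep => b.
  apply: functional_extensionality_dep => a; apply: functional_extensionality_dep => g.
  apply: functional_extensionality_dep => f.
  pose L := labtwolevel x b a.
  pose z : forall v, pelt (lt_lab (lab_ltree relaxed_psh L) v) :=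
    @twolevel_rect n k (fun v => pelt (lt_lab (lab_ltree relaxed_psh L) v))
      (existT (relaxed_psh b a) t f) (fun i => existT (relaxed_psh (x i) (b i)) (ts i) (g i)).
  apply: (@existT_inj _ (pob (relaxed_psh (concat x) a))).
  apply: etrans (@underlying_compE _ enriched_of _ _ _ _ _ _ _ _ _ z erefl (fun _ => erefl)) _.
  apply: relaxed_kappa_eq.
  have := @pevaluates_twolevel _ _ CL n (mkcell f) k (fun i => mkcell (g i))
    (fun i => mkrelt (g i)) (fun _ => erefl).
  congr pevaluates; congr mktfam; by apply: eq_fam => -[[i [[j []]|]]|].
have eid : underlying_id enriched_of = @rid C0 C.
  apply: functional_extensionality_dep => a.
  apply: (@existT_inj _ (pob (relaxed_psh (fun _ => a) a))); rewrite /underlying_id pcastE.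
  pose L := labtriv a.
  pose z : forall v, pelt (lt_lab (lab_ltree relaxed_psh L) v) := fun v : void => match v with end.
  pose w : pelt (relaxed_psh (fun _ => a) a) := existT _ triv (rid C a).
  rewrite -[RHS]/w -(@relaxed_kappa_eq _ _ _ L z w); last exact: pevaluates_leaf.
  set z0 : forall v : vertex triv, TR (arity v) := fun v => match v with end.
  have <- : (fun v => existT (pob (lt_lab (lab_ltree relaxed_psh L) v)) (z0 v) (match v with end)) = z.
    by apply: eq_fam; case.
  by [].
exact: (relaxed_data_ext ecomp eid).
Qed.
End Inverse.

(** * Equality of enriched multicategories and the bijection *)

Lemma enriched_ext C0 (E E' : enriched presheaf_T2 C0) :
  (forall n x a, eC E x a = eC E' x a :> psh n) ->
  (forall n (x : 'I_n -> C0) a (D : labtree x a)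
     (z : forall v, pelt (lt_lab (lab_ltree (eC E) D) v))
     (z' : forall v, pelt (lt_lab (lab_ltree (eC E') D) v)),
     (forall v, mklabelt (z v) = mklabelt (z' v)) ->
     mklabelt (Vap (kappa E D) z) = mklabelt (Vap (kappa E' D) z')) ->
  E = E'.
Proof.
case: E E' => [F K KS KC] [F' K' KS' KC'] /= eF.
have {}eF : F = F'.
  apply: functional_extensionality_dep => n; apply/funext => x; apply/funext => a; exact: eF.
subst F' => eK.
have {}eK : K = K'.
  apply: functional_extensionality_dep => n; apply: functional_extensionality_dep => x.
  apply: functional_extensionality_dep => a; apply: functional_extensionality_dep => D.
  apply: Vhom_ext => z; exact: existT_inj (eK _ _ _ _ z z (fun _ => erefl)).
subst K'; by rewrite (Prop_irrelevance KS' KS) (Prop_irrelevance KC' KC).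
Qed.

Lemma psh_eta n (G : psh n) l1 l2 : @MkPsh n (pob G) (@pact _ G) l1 l2 = G.
Proof. by case: G l1 l2 => ob act m1 m2 l1 l2; rewrite (Prop_irrelevance l1 m1) (Prop_irrelevance l2 m2). Qed.

Lemma mklabelt_eta n (G : psh n) l1 l2 (w : pelt G) :
  mklabelt (G := @MkPsh n (pob G) (@pact _ G) l1 l2) w = mklabelt w.
Proof.
by case: G l1 l2 w => ob act m1 m2 l1 l2 w;
  rewrite (Prop_irrelevance l1 m1) (Prop_irrelevance l2 m2).
Qed.

(** Hom objects agree up to proofs of functoriality. Evaluation and [kappa] both give a value of the
    same family of cells with the same output label, hence the same value. *)
Lemma enriched_of_underlying C0 (E : enriched presheaf_T2 C0) :
  enriched_of (underlying_laws E) = E.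
Proof.
apply: enriched_ext => [n x a|n x a D z z' ez]; first exact: psh_eta.
have {}ez : z = z'.
  apply: eq_fam => v.
  (* Forgets the actions: the sets of the two presheaves agree by conversion, so both elements land
     in one type. *)
  pose phi k (l : labelt k) : {P : TR k -> Type & {t : TR k & P t}} :=
    existT (fun P : TR k -> Type => {t : TR k & P t}) (pob (projT1 l)) (projT2 l).
  exact: existT_inj (congr1 (@phi _) (ez v)).
subst z'.
suff e : Vap (relaxed_kappa (underlying_laws E) D) z = Vap (kappa E D) z.
  apply: etrans (congr1 (@mklabelt n (relaxed_psh (underlying_laws E) x a)) e) _.
  exact: (@mklabelt_eta n (eC E x a)).
have [c Ec ec] := relaxed_kappaP (CL := underlying_laws E) z.
have H := kevaluates_evaluates Ec; rewrite -ec in H.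
have H' : kevaluates (E := E) (mktfam (P := cell (underlying E)) (lab_cells z))
    (pcell (C := underlying E) (mkecell (Vap (kappa E D) z))) by exists n, x, a, D, z.
apply: (@mkecell_inj _ (eC E)); exact: existT_inj (kevaluates_inj H H' erefl).
Qed.

Theorem mainTheorem1 (C0 : Type) :
  exists Phi : enriched presheaf_T2 C0 -> relaxed C0,
    bijective Phi /\
    forall E : enriched presheaf_T2 C0, rel_data (Phi E) = underlying E.
Proof.
exists (fun E => MkRelaxed (underlying_laws E)); split=> //.
exists (fun R => enriched_of (rel_laws R)) => [E|[C CL]] /=.
  exact: enriched_of_underlying.
(* Generalizing over the proof of the laws frees the data to be rewritten. *)
move: (underlying_laws _); rewrite underlying_enriched_of => CL'.
by rewrite (Prop_irrelevance CL' CL).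
Qed.
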